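(* Let $m\ge 4$ be an integer and let $G\in\mathscr{U}_{2m,m}$, i.e. $G$ is a unicyclic graph on $2m$ vertices with matching number $m$. (i) If $m=4$, then $\xi^d(G)\ge 373$, with equality if and only if $G\cong C_5(1^1,1^1,1^1)$. (ii) If $m\ge 5$, then $\xi^d(G)\ge 43m^2-92m+57$, with equality if and only if $G\cong U_{2m,m}$.
   Context: All graphs are finite, simple and connected. For a graph $G$ and $v\in V_G$, $d(u,v)$ is the usual graph distance, $\varepsilon_G(v)=\max_{u\in V_G} d(u,v)$ is the eccentricity, and $D_G(v)=\sum_{u\in V_G} d(u,v)$. The eccentric distance sum is $\xi^d(G)=\sum_{v\in V_G}\varepsilon_G(v)D_G(v)$. A unicyclic graph is a connected graph with $|V_G|=|E_G|$. The matching number is the maximum number of pairwise independent edges. $\mathscr{U}_{n,m}$ is the set of unicyclic graphs with $n$ vertices and matching number $m$. $C_5(1^{1},1^{1},1^{1})$ is the 8-vertex graph obtained from the cycle $C_5=u_1u_2u_3u_4u_5u_1$ by attaching one pendant vertex to each of the three consecutive vertices $u_1,u_2,u_3$. $U_{n,m}$ is the $n$-vertex graph obtained from a triangle $C_3=u_1u_2u_3u_1$ by attaching $n-2m+1$ pendant vertices and $m-2$ pendant paths of length $2$ (each by identifying one of its end vertices with $u_1$) to the single vertex $u_1$. *)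

(* Defs.v *)
From mathcomp Require Import all_boot.

Set Implicit Arguments.
Unset Strict Implicit.
Unset Printing Implicit Defensive.

Record sgraph := SGraph {
  svertex :> finType;
  sedge : rel svertex;
  sedge_sym : symmetric sedge;
  sedge_irrefl : irreflexive sedge
}.

Definition giso (G H : sgraph) : Prop :=
  exists2 f : G -> H, bijective f & forall x y : G, sedge (f x) (f y) = sedge x y.

Section Invariants.

Variable G : sgraph.

Definition connected_graph : bool :=
  (0 < #|G|) && [forall x : G, forall y : G, connect (@sedge G) x y].

Definition edge_set : {set {set G}} := [set [set p.1; p.2] | p : G * G & sedge p.1 p.2].

Definition unicyclic : bool := connected_graph && (#|G| == #|edge_set|).

Definition walk_of_length (k : nat) (u v : G) : bool :=
  [exists p : k.-tuple G, path (@sedge G) u p && (last u p == v)].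

(* Least length of a walk from u to v. Shortest walks have fewer than #|G|
   edges, so the search is over k < #|G|; it returns the junk value #|G| only
   when u and v lie in different components. *)
Definition dist (u v : G) : nat :=
  find (fun k => walk_of_length k u v) (iota 0 #|G|).

Definition eccentricity (v : G) : nat := \max_(u : G) dist u v.

Definition dist_sum (v : G) : nat := \sum_(u : G) dist u v.

Definition ecc_dist_sum : nat := \sum_(v : G) eccentricity v * dist_sum v.

Definition matching (M : {set {set G}}) : bool :=
  (M \subset edge_set) && trivIset M.

Definition matching_number : nat :=
  \max_(M : {set {set G}} | matching M) #|M|.

End Invariants.

Definition unicyclic_class (n m : nat) (G : sgraph) : Prop :=
  [/\ unicyclic G, #|G| = n & matching_number G = m].

Section SymmetricClosure.

Variables (T : finType) (r : rel T).

Definition sym_rel : rel T := fun x y => (x != y) && (r x y || r y x).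

Lemma sym_rel_sym : symmetric sym_rel.
Proof. by move=> x y; rewrite /sym_rel eq_sym orbC. Qed.

Lemma sym_rel_irrefl : irreflexive sym_rel.
Proof. by move=> x; rewrite /sym_rel eqxx. Qed.

Definition sgraph_of : sgraph := SGraph sym_rel_sym sym_rel_irrefl.

End SymmetricClosure.

(* Cycle vertices inl 0, ..., inl 4; the pendant vertex inr k hangs at inl k
   for k = 0, 1, 2, which are consecutive on the cycle. *)
Definition C5_111_rel : rel ('I_5 + 'I_3) := fun x y =>
  match x, y with
  | inl i, inl j => j == i.+1 %% 5 :> nat
  | inl i, inr k => i == k :> nat
  | _, _ => false
  end.

Definition C5_111 : sgraph := sgraph_of C5_111_rel.

(* inl (inl i): triangle vertices, with inl (inl 0) as the attachment vertex;
   inl (inr k): pendant vertices;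
   inr (k, false), inr (k, true): the middle vertex and the free end of the
   k-th pendant path of length 2.
   There are n - 2m + 1 pendant vertices, written so that truncated
   subtraction is harmless as soon as 2m <= n + 1. *)
Definition U_rel (n m : nat) :
    rel ('I_3 + 'I_(n.+1 - 2 * m) + 'I_(m - 2) * bool) := fun x y =>
  match x, y with
  | inl (inl _), inl (inl _) => true
  | inl (inl i), inl (inr _) => i == 0 :> nat
  | inl (inl i), inr (_, b) => (i == 0 :> nat) && ~~ b
  | inr (k, b), inr (l, c) => [&& k == l, ~~ b & c]
  | _, _ => false
  end.

Definition U_graph (n m : nat) : sgraph := sgraph_of (@U_rel n m).

(* Main.v *)
Require Import Defs.
From mathcomp Require Import all_boot.
From mathcomp Require Import zify.

Set Implicit Arguments.
Unset Strict Implicit.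
Unset Printing Implicit Defensive.

(** With [f m = 43 m^2 - 92 m + 57], [f m - f (m - 1) = 86 m - 135]. Induct on
    [m]. If some leaf [b] hangs at a vertex [a] of degree 2 whose other
    neighbour is [c], deleting [a] and [b] leaves a graph of the same kind with
    the same distances, and the sum drops by at least
    [86 m - 135 + 20 (m + 1 - deg c)]. All degrees are at most [m + 1], and a
    vertex of degree [m + 1] forces the graph to be [U_{2m,m}]. If there is no
    such leaf, counting degrees shows that the graph is a cycle with at most
    one pendant vertex at each cycle vertex; balls then grow by at most 4
    vertices per step and the sum exceeds [f m]. The case [m = 4], which also
    starts the induction, is a finite enumeration: up to labelling, the graph
    is one of 24 trees built from 4 matching edges, plus one edge. *)

(** * Distances *)

(** At [m = 4] the formula gives 377, but [C5_111] has only 373, so the induction starts from a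
    graph that violates the bound. It survives because a deletion leaves a slack of 20 for each unit
    by which [deg c] falls short of [m + 1]: restoring a path at a vertex of the exceptional graph
    gives degree at most 5, not 6, and 20 outweighs the deficit 4. Equality leaves no slack, so the
    last deletion exhibits a vertex of degree [m + 1]. Uniqueness is thus read off from one degree
    and need not be carried through the induction. Nor is the value at [U_{2m,m}] computed exactly:
    a vertex of degree [m + 1] yields the upper bound, and the lower bound closes the gap.
    Unicyclicity is used as the degree sum [4m], the matching number as an involution along edges;
    both forms pass to the graph left by a deletion. *)

Section Distance.

Variable G : sgraph.
Implicit Types (u v w : G) (p : seq G).

Lemma walk_of_lengthP k u v :
  reflect (exists p, [/\ size p = k, path (@sedge G) u p & last u p = v])
          (walk_of_length k u v).
Proof.
apply: (iffP existsP) => [[p /andP[pp /eqP lp]]|[p [sp pp lp]]].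
  by exists p; rewrite size_tuple.
by move/eqP in sp; exists (Tuple sp); rewrite /= pp lp eqxx.
Qed.

Lemma dist_le_path u p : path (@sedge G) u p -> dist u (last u p) <= size p.
Proof.
move=> pp; rewrite leqNgt; apply/negP => lt_p.
have := before_find 0 lt_p.
rewrite nth_iota ?add0n; last first.
  by apply: leq_trans lt_p _; rewrite -[X in _ <= X](size_iota 0) find_size.
by move/walk_of_lengthP; case; exists p.
Qed.

Lemma distxx u : dist u u = 0.
Proof. by apply/eqP; rewrite -leqn0; apply: (@dist_le_path u [::]). Qed.

Lemma dist_edge_le u v : sedge u v -> dist u v <= 1.
Proof. by move=> uv; apply: (@dist_le_path u [:: v]); rewrite /= uv. Qed.

Hypothesis G_conn : connected_graph G.

(** A connecting path shortens to one without repeated vertices, hence of length below [#|G|]; so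
    the [find] in [dist] succeeds and its default value does not occur. *)
Lemma dist_pathE u v :
  exists p, [/\ path (@sedge G) u p, last u p = v & size p = dist u v].
Proof.
have /andP[_ /forallP /(_ u) /forallP /(_ v) /connectP[p0 pp0 lp0]] := G_conn.
case/shortenP: pp0 lp0 => p pp up _ lp.
have lt_p : size p < #|G|.
  by rewrite -[_.+1]/(size (u :: p)) -(card_uniqP up) max_card.
have hw : has (fun k => walk_of_length k u v) (iota 0 #|G|).
  apply/hasP; exists (size p); first by rewrite mem_iota.
  by apply/walk_of_lengthP; exists p.
have := nth_find 0 hw; rewrite -/(dist u v) nth_iota ?add0n.
  by case/walk_of_lengthP => q [? ? ?]; exists q.
by move: hw; rewrite has_find size_iota.
Qed.

Lemma dist_lt_card u v : dist u v < #|G|.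
Proof.
have [p [pp lp sp]] := dist_pathE u v.
case/shortenP: pp lp => q pq uq _ lq; rewrite -lq.
apply: leq_ltn_trans (dist_le_path pq) _.
by rewrite -[_.+1]/(size (u :: q)) -(card_uniqP uq) max_card.
Qed.

Lemma dist_eq0 u v : (dist u v == 0) = (u == v).
Proof.
apply/eqP/eqP => [d0|->]; last exact: distxx.
by have [p [_ lp]] := dist_pathE u v; rewrite d0 => /size0nil p0; rewrite -lp p0.
Qed.

Lemma dist_gt0 u v : (0 < dist u v) = (u != v).
Proof. by rewrite lt0n dist_eq0. Qed.

Lemma dist_triangle w u v : dist u v <= dist u w + dist w v.
Proof.
have [p [pp lp <-]] := dist_pathE u w; have [q [pq lq <-]] := dist_pathE w v.
rewrite -size_cat.
have -> : v = last u (p ++ q) by rewrite last_cat lp lq.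
by apply: dist_le_path; rewrite cat_path pp lp.
Qed.

Lemma dist_symm u v : dist u v = dist v u.
Proof.
suff le_d (x y : G) : dist x y <= dist y x by apply/eqP; rewrite eqn_leq !le_d.
have [p [pp lp <-]] := dist_pathE y x.
elim: p y pp lp => [|z p IHp] y /=; first by move=> _ ->; rewrite distxx.
case/andP=> yz pz lz; apply: leq_trans (dist_triangle z _ _) _.
by rewrite -addn1 leq_add ?IHp // dist_edge_le // sedge_sym.
Qed.

Lemma dist_edge u v : sedge u v -> dist u v = 1.
Proof.
move=> uv; apply/eqP; rewrite eqn_leq dist_edge_le // dist_gt0.
by apply: contraTneq uv => ->; rewrite sedge_irrefl.
Qed.

Lemma dist_le1 u v : (dist u v <= 1) = (u == v) || sedge u v.
Proof.
apply/idP/orP => [d1|[/eqP ->|/dist_edge ->//]]; last by rewrite distxx.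
have [p [pp lp sp]] := dist_pathE u v; rewrite -sp in d1.
case: p d1 pp lp {sp} => [|x [|? ?]] //= _; first by move=> _ ->; left.
by rewrite andbT => ? <-; right.
Qed.

Lemma dist_edge_lipschitz w u v : sedge u v -> dist w v <= (dist w u).+1.
Proof. by move/dist_edge=> uv; rewrite -addn1 -uv dist_triangle. Qed.

Lemma dist_pred u v : u != v ->
  exists2 w, sedge w v & dist u v = (dist u w).+1.
Proof.
move=> uv; have [p [pp lp sp]] := dist_pathE u v.
case: (lastP p) pp lp sp => [|q x] pp.
  by move=> /= lp; rewrite lp eqxx in uv.
rewrite last_rcons => xv sp; move: pp; rewrite {}xv rcons_path => /andP[pq qv].
exists (last u q) => //; rewrite size_rcons in sp.
have le1 := dist_le_path pq; have le2 := dist_edge_lipschitz u qv.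
by move: le1 le2; rewrite -sp; lia.
Qed.

End Distance.

(** * Perfect matchings, and distance sums through ball sizes *)

Definition deg (G : sgraph) (v : G) := #|[set u | sedge v u]|.

(** Tail counts: summed over [k] they give the distance sum, and the number of nonzero ones is the
    eccentricity, so bounds on balls control both. *)
Definition far (G : sgraph) (k : nat) (v : G) := #|[set u | k < dist v u]|.

(* A perfect matching, encoded as the involution sending each vertex to its
   partner. *)
Definition perfect_mate (G : sgraph) (mate : G -> G) :=
  involutive mate /\ forall v, sedge v (mate v).

Lemma sum_ltn n d : \sum_(k < n) (k < d) = minn n d.
Proof.
rewrite -(big_mkord predT (fun k => nat_of_bool (k < d))).
elim: n => [|n IHn]; first by rewrite big_nil min0n.
by rewrite big_nat_recr //= IHn; lia.
Qed.

Lemma sum_deg (G : sgraph) :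
  \sum_(v : G) deg v = #|[set p : G * G | sedge p.1 p.2]|.
Proof.
rewrite -sum1dep_card -(pair_big_dep xpredT (fun u v => sedge u v) (fun _ _ => 1)) /=.
by apply: eq_bigr => v _; rewrite sum1dep_card.
Qed.

Lemma handshake (G : sgraph) : \sum_(v : G) deg v = 2 * #|edge_set G|.
Proof.
rewrite sum_deg -sum1_card (partition_big_imset (fun p : G * G => [set p.1; p.2])) /=.
have -> : [set [set p.1; p.2] | p in [set p : G * G | sedge p.1 p.2]] = edge_set G.
  by apply/setP=> e; apply/imsetP/imsetP => -[p]; rewrite ?inE => pE ->;
     exists p; rewrite ?inE.
rewrite mulnC -sum_nat_const; apply: eq_bigr => _ /imsetP[[x y] /[!inE] /= xy ->].
have neq_xy : x != y by apply: contraTneq xy => ->; rewrite sedge_irrefl.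
(* The arcs above an edge are its two orientations. *)
transitivity #|[set (x, y); (y, x)]|; last first.
  by rewrite cards2 xpair_eqE negb_and neq_xy.
rewrite sum1dep_card; congr #|pred_of_set _|.
apply/setP=> -[u v]; rewrite !inE !xpair_eqE /=; apply/andP/orP.
  case=> uv /eqP/setP E; have neq_uv : u != v.
    by apply: contraTneq uv => ->; rewrite sedge_irrefl.
  have := E u; have := E v; rewrite !inE !eqxx orbT /=.
  move=> /esym/orP[]/eqP Ev /esym/orP[]/eqP Eu; subst u v.
  - by rewrite eqxx in neq_uv.
  - by right; rewrite !eqxx.
  - by left; rewrite !eqxx.
  - by rewrite eqxx in neq_uv.
case=> /andP[/eqP-> /eqP->]; split=> //; first by rewrite sedge_sym.
by rewrite setUC.
Qed.

Lemma perfect_mate_exists (G : sgraph) :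
  #|G| = 2 * matching_number G -> exists mate : G -> G, perfect_mate mate.
Proof.
rewrite /matching_number => cG.
have m0 : @matching G set0 by rewrite /matching sub0set /trivIset /cover !big_set0 cards0.
move: cG; rewrite (bigmax_eq_arg _ m0); case: arg_maxnP => // M /andP[sM tM] _ cG.
have card2 A : A \in M -> exists x y, A = [set x; y] /\ sedge x y.
  by move/(subsetP sM) => /imsetP[[x y] /[!inE] /= xy ->]; exists x, y.
(* Disjoint pairs, half as many as there are vertices, leave no vertex out. *)
have cov : cover M = setT.
  apply/eqP; rewrite eqEcard subsetT cardsT cG -(eqP tM) mulnC -sum_nat_const.
  apply: leq_sum => A /card2[x [y [-> xy]]].
  rewrite cards2; have -> // : x != y.
  by apply: contraTneq xy => ->; rewrite sedge_irrefl.
have mate_ex v : exists u, ([set v; u] \in M) && sedge v u.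
  have : v \in cover M by rewrite cov inE.
  case/bigcupP => A AM; have [x [y [EA xy]]] := card2 A AM.
  rewrite EA !inE in AM *; case/orP => /eqP->.
    by exists y; rewrite AM.
  by exists x; rewrite setUC AM sedge_sym.
pose mate v := xchoose (mate_ex v).
have mP v : [set v; mate v] \in M /\ sedge v (mate v).
  exact/andP/(xchooseP (mate_ex v)).
exists mate; split=> [v|v]; last by case: (mP v).
have [M1 e1] := mP v; have [M2 e2] := mP (mate v).
have := trivIsetP tM _ _ M1 M2; case: eqVneq => [E _|_ /(_ isT)].
  move/setP/(_ v): E; rewrite !inE eqxx /= => /esym/orP[/eqP E'|/eqP<- //].
  by rewrite -E' sedge_irrefl in e1.
by move/pred0P => /(_ (mate v)) /=; rewrite !inE !eqxx orbT.
Qed.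

Section Invariants.

Variables (G : sgraph) (G_conn : connected_graph G).
Implicit Types u v w : G.

Lemma dist_sum_symm v : dist_sum v = \sum_u dist v u.
Proof. by apply: eq_bigr => u _; rewrite dist_symm. Qed.

Lemma dist_le_ecc u v : dist v u <= eccentricity v.
Proof. by rewrite dist_symm //; exact: (leq_bigmax u). Qed.

Lemma ecc_le k v : (forall u, dist v u <= k) -> eccentricity v <= k.
Proof. by move=> le_k; apply/bigmax_leqP => u _; rewrite dist_symm. Qed.

Lemma farE k v : far k v = \sum_u (k < dist v u).
Proof.
rewrite /far -sum1_card big_mkcond; apply: eq_bigr => u _.
by rewrite inE; case: ltnP.
Qed.

Lemma sum_far n v : \sum_(k < n) far k v = \sum_u minn n (dist v u).
Proof.
under [LHS]eq_bigr => k _ do rewrite farE.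
rewrite exchange_big.
by apply: eq_bigr => u _; rewrite sum_ltn.
Qed.

Lemma sum_far_le n v : \sum_(k < n) far k v <= dist_sum v.
Proof. by rewrite sum_far dist_sum_symm; apply: leq_sum => u _; lia. Qed.

Lemma dist_sumE v : dist_sum v = \sum_(k < #|G|) far k v.
Proof.
rewrite sum_far dist_sum_symm; apply: eq_bigr => u _.
by have := dist_lt_card G_conn v u; lia.
Qed.

Lemma far_gt0 k v : (0 < far k v) = (k < eccentricity v).
Proof.
apply/card_gt0P/idP => [[u]|lt_k]; first by rewrite inE => /leq_trans; apply; exact: dist_le_ecc.
have [u Eu] : {u | eccentricity v = dist u v}.
  by apply: eq_bigmax; apply/card_gt0P; exists v.
by exists u; rewrite inE dist_symm // -Eu.
Qed.

Lemma eccE v : eccentricity v = \sum_(k < #|G|) (0 < far k v).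
Proof.
under eq_bigr do rewrite far_gt0; rewrite sum_ltn.
suff : eccentricity v <= #|G| by lia.
by apply/ecc_le => u; apply/ltnW/dist_lt_card.
Qed.

Lemma ball_far k v : #|[set u | dist v u <= k]| + far k v = #|G|.
Proof.
rewrite /far -[RHS](cardC (mem [set u | dist v u <= k])) !cardE.
by congr (_ + _); rewrite -!cardE; apply: eq_card => u; rewrite !inE ltnNge.
Qed.

(** * A leaf compared with its neighbour *)

Section Leaf.

Variables (l a : G).
Hypotheses (la : sedge l a) (l1 : deg l = 1).

Lemma leaf_nbr u : sedge l u = (u == a).
Proof.
have /cards1P[z Ez] := introT eqP l1.
move/setP: Ez => E; have := E u; have := E a; rewrite !inE la => /esym/eqP->.
by [].
Qed.

Lemma leaf_dist u : u != l -> dist l u = (dist a u).+1.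
Proof.
move=> ul; have [w wl E] := dist_pred G_conn ul.
rewrite sedge_sym leaf_nbr in wl.
by rewrite dist_symm // E (eqP wl) dist_symm.
Qed.

Lemma leaf_dist_sum : 1 < #|G| -> dist_sum l = dist_sum a + (#|G| - 2).
Proof.
move=> G1; rewrite !dist_sum_symm (bigD1 l) //= [in RHS](bigD1 l) //= distxx.
rewrite (eq_bigr (fun u => dist a u + 1)); last by move=> u ?; rewrite leaf_dist // addn1.
rewrite big_split /= dist_edge //; last by rewrite sedge_sym.
rewrite sum1_card (cardC1 l : _ = _).
rewrite add0n; move: G1; move: (\sum_(i | _) _) #|_| => S n. lia.
Qed.

(** A vertex farthest from [a] is at distance at least 2, so it is not [l], and it is one step
    farther from [l]. *)
Lemma leaf_ecc : 1 < eccentricity a -> eccentricity a < eccentricity l.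
Proof.
case E: (eccentricity a) => [|[|k]] // _.
have : 0 < far k.+1 a by rewrite far_gt0 E.
case/card_gt0P => u; rewrite inE => au.
apply: leq_trans (dist_le_ecc u l); rewrite leaf_dist //.
by apply: contraTneq au => ->; rewrite dist_edge // sedge_sym.
Qed.

End Leaf.

End Invariants.

(** * Maximum degree *)

Lemma bfs_parent (G : sgraph) (c : G) : connected_graph G ->
  exists par : G -> G, forall v, v != c ->
    sedge v (par v) /\ dist c v = (dist c (par v)).+1.
Proof.
move=> G_conn.
(* The implication gives the root a dummy witness, so that [xchoose] defines the parent
   everywhere. *)
have par_ex v : exists w, (v != c) ==> sedge v w && (dist c v == (dist c w).+1).
  case: (eqVneq v c) => [_|]; first by exists v.
  rewrite eq_sym => /(dist_pred G_conn)[w wv E].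
  by exists w; rewrite sedge_sym wv E eqxx.
exists (fun v => xchoose (par_ex v)) => v vc.
by have /implyP/(_ vc)/andP[? /eqP] := xchooseP (par_ex v).
Qed.

Lemma giso_of_inj (G H : sgraph) (g : H -> G) :
  injective g -> #|G| <= #|H| ->
  (forall x y, sedge (g x) (g y) = sedge x y) -> giso G H.
Proof.
move=> g_inj le_card gE; have [f fK gK] := inj_card_bij g_inj le_card.
exists f; first by exists g.
by move=> x y; rewrite -gE !gK.
Qed.

Section Unicyclic.

Variables (G : sgraph) (m : nat).
Hypotheses (G_conn : connected_graph G) (cardG : #|G| = 2 * m).
Hypothesis sum_degG : \sum_(v : G) deg v = 4 * m.

(** * Breadth-first tree and the arcs outside it *)

Section Parent.

Variables (c : G) (par : G -> G).
Hypothesis parP : forall v, v != c ->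
  sedge v (par v) /\ dist c v = (dist c (par v)).+1.

Definition up_arcs := [set p : G * G | (p.1 != c) && (p.2 == par p.1)].
Definition down_arcs := [set p : G * G | (p.2 != c) && (p.1 == par p.2)].
Definition extra_arcs :=
  [set p : G * G | sedge p.1 p.2] :\: (up_arcs :|: down_arcs).

(* The BFS tree has [2m - 1] of the [2m] edges, so a single edge is left, which
   is two arcs. *)
Lemma card_extra_arcs : #|extra_arcs| = 2.
Proof.
have up : #|up_arcs| = 2 * m - 1.
  have -> : up_arcs = [set (v, par v) | v in [set~ c]].
    apply/setP=> -[u v]; rewrite inE /=; apply/andP/imsetP.
      by case=> uc /eqP->; exists u => //; rewrite !inE.
    by case=> w; rewrite !inE => wc [-> ->]; rewrite eqxx.
  by rewrite card_imset ?cardsC1 ?cardG ?subn1 // => u v [].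
have down : #|down_arcs| = 2 * m - 1.
  have -> : down_arcs = [set (par v, v) | v in [set~ c]].
    apply/setP=> -[u v]; rewrite inE /=; apply/andP/imsetP.
      by case=> vc /eqP->; exists v => //; rewrite !inE.
    by case=> w; rewrite !inE => wc [-> ->]; rewrite eqxx.
  by rewrite card_imset ?cardsC1 ?cardG ?subn1 // => u v [].
have disj : [disjoint up_arcs & down_arcs].
  apply/pred0P => -[u v]; rewrite /= !inE /=; apply/negP.
  case/andP=> /andP[uc /eqP v_u] /andP[vc /eqP u_v].
  have [_ E1] := parP uc; have [_ E2] := parP vc.
  by rewrite -v_u in E1; rewrite -u_v in E2; lia.
have sub : up_arcs :|: down_arcs \subset [set p : G * G | sedge p.1 p.2].
  apply/subsetP => -[u v]; rewrite !inE /= => /orP[]/andP[uc /eqP->].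
    by case: (parP uc).
  by rewrite sedge_sym; case: (parP uc).
have G0 : 0 < #|G| by apply/card_gt0P; exists c.
rewrite /extra_arcs cardsD (setIidPr sub) -sum_deg sum_degG.
rewrite cardsU (disjoint_setI0 disj) cards0 up down; lia.
Qed.

End Parent.

Section Matched.

Variable mate : G -> G.
Hypothesis mateP : perfect_mate mate.

Let mateK : involutive mate. Proof. by case: mateP. Qed.
Let mate_edge v : sedge v (mate v). Proof. by case: mateP. Qed.
Let mate_neq v : mate v != v.
Proof. by apply: contraTneq (mate_edge v) => ->; rewrite sedge_irrefl. Qed.

(** * Neighbours of [c], sorted by whether their partner is also a neighbour *)

Section Vertex.

Variable c : G.
Let N := [set u | sedge c u].
Let A := [set v in N | mate v \in N].
Let B := [set v in N | (v != mate c) && (mate v \notin N)].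
Let O := ~: (c |: N).

Let distN v : (v \in N) = (dist c v == 1).
Proof.
rewrite inE; have := dist_le1 G_conn c v; have := dist_eq0 G_conn c v.
case: (eqVneq c v) => [<-|_] /=; first by rewrite distxx sedge_irrefl.
by move=> + <-; case: (dist c v) => [|[|]].
Qed.

Let c_notin_N : c \notin N. Proof. by rewrite inE sedge_irrefl. Qed.

Let card_N : #|N| = (#|A| + #|B|).+1.
Proof.
have wN : mate c \in N by rewrite inE.
rewrite (cardsD1 (mate c)) wN add1n -(cardsID A (N :\ mate c)).
congr (_ + _).+1; apply: eq_card => v; rewrite !inE.
  case: eqVneq => [->|_] /=; first by rewrite mateK sedge_irrefl !andbF.
  by case: (sedge c v).
by case: (sedge c v); rewrite ?andbF //= andbT andbC.
Qed.

Let card_NO : (#|N| + #|O|).+1 = 2 * m.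
Proof. by rewrite -cardG -(cardsC (c |: N)) cardsU1 c_notin_N. Qed.

(* An edge inside [N] joins two vertices of equal depth, so it is the non-tree
   edge. *)
Let card_A : #|A| <= 2.
Proof.
have [par parP] := bfs_parent c G_conn.
rewrite -(card_extra_arcs parP) -(card_imset (f := fun v => (v, mate v))) //.
  apply/subset_leq_card/subsetP => _ /imsetP[v vA ->].
  move: vA; rewrite inE !distN => /andP[/eqP v1 /eqP mv1].
  rewrite !inE mate_edge andbT negb_or !negb_and !negbK /=.
  apply/andP; split; rewrite -implyNb; apply/implyP=> /parP[_ E];
    apply: contra_eqN E => /eqP<-; rewrite v1 mv1 //.
by move=> u v [].
Qed.

Let mate_B v : v \in B -> mate v \in O.
Proof.
rewrite !inE => /andP[_ /andP[vw mvN]]; rewrite negb_or mvN andbT.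
by apply: contra_neq vw => <-; rewrite mateK.
Qed.

Let card_B : #|B| <= #|O|.
Proof.
rewrite -(card_imset _ (inv_inj mateK)); apply/subset_leq_card/subsetP.
by move=> _ /imsetP[v vB ->]; apply: mate_B.
Qed.

(* The neighbours of [c] other than its partner are matched inside [N] (at most
   two of them) or injectively into [O]. *)
Lemma deg_le : deg c <= m.+1.
Proof. by move: card_N card_NO card_A card_B; rewrite /deg -/N; lia. Qed.

(** * Structure around a vertex of maximum degree *)

Hypothesis deg_c : deg c = m.+1.

(** The degree bound is attained, so each inequality behind it is an equality; in particular the
    matching is a bijection between [B] and [O]. *)
Let cards : [/\ #|A| = 2, #|B| = m - 2 & #|O| = m - 2].
Proof.
by move: card_N card_NO card_A card_B deg_c; rewrite /deg -/N => *; split; lia.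
Qed.

Let m_ge2 : 2 <= m.
Proof. by move: card_N card_NO card_A card_B deg_c; rewrite /deg -/N; lia. Qed.

Let mate_O v : v \in O -> mate v \in B.
Proof.
have [_ cB cO] := cards; have : mate @: B = O.
  apply/eqP; rewrite eqEcard (card_imset _ (inv_inj mateK)) cB cO leqnn andbT.
  by apply/subsetP => _ /imsetP[u uB ->]; apply: mate_B.
by move=> <- /imsetP[u uB ->]; rewrite mateK.
Qed.

(** The pair matched inside [N] uses up both non-tree arcs. All other edges join a vertex to its
    parent, which is [c] for a vertex of [N] and the partner for a vertex of [O]. *)
Lemma max_deg_edge u v :
  sedge u v = [|| (u == c) && (v \in N), (v == c) && (u \in N) | v == mate u].
Proof.
have [cA _ _] := cards.
have [par parP] := bfs_parent c G_conn.
have parN x : x \in N -> par x = c.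
  move=> xN; have [|_] := parP x; first by apply: contraTneq xN => ->.
  move: xN; rewrite distN => /eqP-> [] /esym /eqP.
  by rewrite dist_eq0 // => /eqP.
have extraE : extra_arcs c par = [set (x, mate x) | x in A].
  apply/esym/eqP; rewrite eqEcard card_extra_arcs // card_imset ?cA ?andbT; last by move=> x y [].
  apply/subsetP => _ /imsetP[x xA ->].
  have [xN yN] : x \in N /\ mate x \in N by apply/andP; rewrite inE in xA.
  rewrite !inE mate_edge andbT negb_or !negb_and !negbK /=.
  by rewrite !parN // !(negbTE (contraNneq _ c_notin_N)) ?orbT //; do ?[move=> <-].
have parO x : x \in O -> par x = mate x.
  move=> xO; have xN : x \notin N by move: xO; rewrite inE in_setU1 negb_or => /andP[].
  have xc : x != c by move: xO; rewrite inE in_setU1 negb_or => /andP[].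
  have mxN : mate x \in N by move: (mate_O xO); rewrite inE => /andP[].
  have : (x, mate x) \notin extra_arcs c par.
    rewrite extraE; apply: contra xN => /imsetP[y yA [-> _]].
    by move: yA; rewrite inE => /andP[].
  rewrite !inE mate_edge andbT negbK /= xc (parN _ mxN) (negbTE xc) andbF orbF.
  by move/eqP.
have parE x : x != c -> (x \in N /\ par x = c) \/ par x = mate x.
  move=> xc; case: (boolP (x \in N)) => [xN|xN]; first by left; rewrite parN.
  by right; apply: parO; rewrite inE in_setU1 negb_or xc.
apply/idP/or3P => [uv|]; last first.
  case=> [/andP[/eqP-> ]|/andP[/eqP->]|/eqP->]; rewrite ?inE //.
  by rewrite sedge_sym.
case: (boolP ((u, v) \in extra_arcs c par)) => [|].
  by rewrite extraE => /imsetP[x _ [-> ->]]; constructor 3.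
rewrite !inE uv andbT negbK /= => /orP[]/andP[wc /eqP E].
  have [[uN pu]|pu] := parE _ wc; last by constructor 3; rewrite E pu.
  by constructor 2; rewrite E pu eqxx; rewrite inE in uN.
have [[vN pv]|pv] := parE _ wc; last by constructor 3; rewrite E pv mateK.
by constructor 1; rewrite E pv eqxx; rewrite inE in vN.
Qed.

Let class_cover v :
  [|| v == c, v == mate c, v \in A, v \in B | v \in O].
Proof.
case: (eqVneq v c) => //= vc; case: (eqVneq v (mate c)) => //= vw.
rewrite !inE vw (negbTE vc) /=.
by case: (sedge c v); rewrite ?orbT //=; case: (sedge c (mate v)).
Qed.

Let sum_mem (S : {set G}) k : \sum_v (v \in S) * k = #|S| * k.
Proof.
rewrite -big_distrl -sum1_card [in RHS]big_mkcond /=.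
by congr (_ * _); apply: eq_bigr => v _; case: (v \in S).
Qed.

Let class_sum (F : G -> nat) kc kw kA kB kO :
  F c <= kc -> F (mate c) <= kw -> {in A, forall v, F v <= kA} ->
  {in B, forall v, F v <= kB} -> {in O, forall v, F v <= kO} ->
  \sum_v F v <= kc + kw + 2 * kA + (m - 2) * (kB + kO).
Proof.
move=> Fc Fw FA FB FO; have [cA cB cO] := cards.
have le_v v : F v <= (v \in [set c]) * kc + (v \in [set mate c]) * kw
                     + (v \in A) * kA + (v \in B) * kB + (v \in O) * kO.
  rewrite !in_set1; case/or4P: (class_cover v) => [/eqP->|/eqP->|vA|].
  - by rewrite eqxx; lia.
  - by rewrite eqxx; lia.
  - by have := FA _ vA; rewrite vA; lia.
  - by case/orP=> vX; [have := FB _ vX | have := FO _ vX]; rewrite vX; lia.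
apply: leq_trans; first by apply: leq_sum => v _; apply: le_v.
by rewrite !big_split /= !sum_mem !cards1 cA cB cO; lia.
Qed.

Let dist_A v : v \in A -> dist c v = 1 /\ dist c (mate v) = 1.
Proof. by rewrite inE !distN => /andP[/eqP-> /eqP->]. Qed.

Let dist_O v : v \in O -> dist c v <= 2 /\ dist c (mate v) = 1.
Proof.
move=> vO; have : mate v \in N by move: (mate_O vO); rewrite inE => /andP[].
rewrite distN => /eqP mv1; split=> //; rewrite -[2]/(1 + 1) -[X in X + _]mv1.
apply: leq_trans (dist_triangle G_conn (mate v) c v) _.
by rewrite leq_add2l dist_edge_le // sedge_sym.
Qed.

Let dist_B v : v \in B -> dist c v = 1 /\ dist c (mate v) = 2.
Proof.
move=> vB; have vN : v \in N by move: vB; rewrite inE => /andP[].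
have mvO := mate_B vB; have [le2 _] := dist_O mvO.
split; first by move: vN; rewrite distN => /eqP.
move: mvO; rewrite inE in_setU1 negb_or distN => /andP[].
by rewrite eq_sym -(dist_eq0 G_conn); case: (dist c _) le2 => [|[|[|]]].
Qed.

Let dist_w : dist c (mate c) = 1. Proof. exact/dist_edge. Qed.

Let dist_le2 v : dist c v <= 2.
Proof.
case/or4P: (class_cover v) => [/eqP->|/eqP->|/dist_A[-> _]|/orP[/dist_B[-> _]|/dist_O[]]] //.
  by rewrite distxx.
by rewrite dist_w.
Qed.

Let ecc_bound v : eccentricity v <= dist c v + 2.
Proof.
apply/ecc_le => // u; apply: leq_trans (dist_triangle G_conn c v u) _.
by rewrite (dist_symm G_conn v c) leq_add2l dist_le2.
Qed.

Let sum_dist_c : \sum_u dist c u <= 3 * m - 3.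
Proof.
apply: leq_trans (class_sum (F := dist c) (kc := 0) (kw := 1) (kA := 1) (kB := 1) (kO := 2) _ _ _ _ _) _.
- by rewrite distxx.
- by rewrite dist_w.
- by move=> v /dist_A[->].
- by move=> v /dist_B[->].
- by move=> v /dist_O[].
by move: m_ge2; lia.
Qed.

(** Distances from [v] are bounded by going through [c], except at [v] itself and at its partner,
    where the true values 0 and 1 are kept; the left-hand side records these savings. *)
Let dist_sum_bound v :
  dist_sum v + 3 * dist c v + dist c (mate v)
    <= 1 + 2 * m * dist c v + \sum_u dist c u.
Proof.
rewrite dist_sum_symm // -[in leqRHS]addnA.
have -> : 2 * m * dist c v + \sum_u dist c u = \sum_u (dist c v + dist c u).
  by rewrite big_split /= sum_nat_const cardG.
rewrite (bigD1 v) //= (bigD1 (mate v)) //= [in leqRHS](bigD1 v) //= [in leqRHS](bigD1 (mate v)) //=.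
rewrite distxx (dist_edge G_conn (mate_edge v)).
have : \sum_(u | (u != v) && (u != mate v)) dist v u
   <= \sum_(u | (u != v) && (u != mate v)) (dist c v + dist c u).
  apply: leq_sum => u _; rewrite (dist_symm G_conn c v); exact: dist_triangle.
by move: (\sum_(u | _) _) (\sum_(u | _) _) => S1 S2; lia.
Qed.

(** The class bounds on eccentricity and distance sum add up to exactly the extremal polynomial, so
    an upper estimate suffices against the general lower bound. *)
Lemma ecc_dist_sum_max_deg : ecc_dist_sum G <= 43 * m ^ 2 - 92 * m + 57.
Proof.
have prod v k : dist_sum v <= k -> eccentricity v * dist_sum v <= (dist c v + 2) * k.
  by move=> le_k; rewrite leq_mul ?ecc_bound.
have S := sum_dist_c; have M := m_ge2.
apply: leq_trans (class_sum (kc := 2 * (3 * m - 3)) (kw := 3 * (5 * m - 5))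
  (kA := 3 * (5 * m - 6)) (kB := 3 * (5 * m - 7)) (kO := 4 * (7 * m - 9)) _ _ _ _ _) _.
- have := @prod c (3 * m - 3); rewrite distxx; apply.
  by have := dist_sum_bound c; rewrite distxx dist_w; lia.
- have := @prod (mate c) (5 * m - 5); rewrite dist_w; apply.
  by have := dist_sum_bound (mate c); rewrite mateK distxx dist_w; lia.
- move=> v vA; have [E1 E2] := dist_A vA.
  have := @prod v (5 * m - 6); rewrite E1; apply.
  by have := dist_sum_bound v; rewrite E1 E2; lia.
- move=> v vB; have [E1 E2] := dist_B vB.
  have := @prod v (5 * m - 7); rewrite E1; apply.
  by have := dist_sum_bound v; rewrite E1 E2; lia.
- move=> v vO; have [E1 E2] := dist_O vO.
  apply: leq_trans (@prod v (7 * m - 9) _) _; last by rewrite leq_mul2r; apply/orP; right; lia.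
  have := dist_sum_bound v; rewrite E2 => D.
  have : (2 * m - 3) * dist c v <= (2 * m - 3) * 2 by rewrite leq_mul2l E1 orbT.
  by move: D; rewrite mulnBl; nia.
have := m_ge2; case: (m) => [|[|k]] // _; nia.
Qed.

Let card_U : #|U_graph (2 * m) m| = 2 * m.
Proof.
rewrite !card_sum card_prod card_bool !card_ord.
by move: m_ge2; lia.
Qed.

Lemma max_deg_giso : giso G (U_graph (2 * m) m).
Proof.
have [cA cB _] := cards.
have [x xA] : exists x, x \in A by apply/card_gt0P; rewrite cA.
have mAA v : v \in A -> mate v \in A by rewrite !inE mateK andbC.
pose y := mate x; have yA : y \in A := mAA _ xA.
have xy : x != y by rewrite eq_sym mate_neq.
have AN v : v \in A -> v \in N by rewrite inE => /andP[].
have BN v : v \in B -> v \in N by rewrite inE => /andP[].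
have wN : mate c \in N by rewrite inE.
have wA : mate c \notin A by rewrite !inE mateK sedge_irrefl andbF.
have wB : mate c \notin B by rewrite !inE eqxx andbF.
have AB v : v \in A -> v \notin B.
  by rewrite !inE => /andP[_ ->]; rewrite !andbF.
have NO v : v \in N -> v \notin O by move=> vN; rewrite in_setC in_setU1 negbK vN orbT.
have cO : c \notin O by rewrite in_setC setU11.
have ncN v : v \in N -> (v == c) = false.
  by move=> vN; apply: contraTF vN => /eqP->.
(* For [n = 2m] there is a single pendant vertex at the hub; it will be [mate c]. *)
pose z : 'I_((2 * m).+1 - 2 * m) := Ordinal (etrans (congr1 (leq 1) (subSnn (2 * m))) isT).
have z_uniq i : i = z by apply: ord_inj; have := ltn_ord i; rewrite /=; lia.
have size_B : size (enum B) = m - 2 by rewrite -cardE.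
pose b (k : 'I_(m - 2)) := nth c (enum B) k.
have bB k : b k \in B by rewrite -mem_enum mem_nth ?size_B.
have b_inj : injective b.
  move=> k l /eqP; rewrite nth_uniq ?size_B ?enum_uniq // => /eqP E.
  exact: ord_inj.
pose g (p : U_graph (2 * m) m) : G := match p with
  | inl (inl i) => nth c [:: c; x; y] i
  | inl (inr _) => mate c
  | inr (k, t) => if t then mate (b k) else b k
  end.
(* [isc], [inN] and [mu] are the pullbacks along [g] of being [c], lying in [N], and [mate]; with
   them [max_deg_edge] becomes a case check on the labels. *)
pose isc (p : U_graph (2 * m) m) := if p is inl (inl i) then i == 0 :> nat else false.
pose inN (p : U_graph (2 * m) m) := match p with
  | inl (inl i) => i != 0 :> nat
  | inl (inr _) => true
  | inr (k, t) => ~~ t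
  end.
pose mu (p : U_graph (2 * m) m) : U_graph (2 * m) m := match p with
  | inl (inl i) => match val i with
     | 0 => inl (inr z) | 1 => inl (inl (inord 2)) | _ => inl (inl (inord 1)) end
  | inl (inr _) => inl (inl ord0)
  | inr (k, t) => inr (k, ~~ t)
  end.
have g_c p : (g p == c) = isc p.
  case: p => [[[[|[|[|]]] ?]|i]|[k []]] //=.
  - exact: eqxx.
  - exact/ncN/AN.
  - exact/ncN/AN.
  - exact: ncN.
  - by apply: contraNF cO => /eqP<-; apply: mate_B.
  - exact/ncN/BN.
have g_N p : (g p \in N) = inN p.
  case: p => [[[[|[|[|]]] ?]|i]|[k []]] //=.
  - exact: negbTE.
  - exact: AN.
  - exact: AN.
  - by apply: contraTF (mate_B (bB k)) => /NO.
  - exact: BN.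
have g_mu p : mate (g p) = g (mu p).
  case: p => [[[[|[|[|]]] ?]|i]|[k []]] //=; rewrite ?inordK ?mateK //.
pose inA (p : U_graph (2 * m) m) := if p is inl (inl i) then i != 0 :> nat else false.
have g_A p : (g p \in A) = inA p.
  case: p => [[[[|[|[|]]] ?]|i]|[k []]] //=.
  - by apply: contraNF c_notin_N => /AN.
  - exact: negbTE.
  - by apply: contraTF (mate_B (bB k)) => /AN /NO.
  - by apply: contraTF (bB k) => /AB.
have g_inj : injective g.
  move=> p q E; have := g_A p; have := g_c p; have := g_N p; rewrite E g_c g_N g_A.
  case: p E => [[i|i]|[k t]]; case: q => [[j|j]|[l u]] /=; try by case: (val _).
  - move/eqP; rewrite nth_uniq //= => [/eqP/ord_inj->//|].
    rewrite !inE negb_or xy andbT /= eq_sym ncN ?AN // eq_sym ncN ?AN //.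
  - by rewrite (z_uniq i) (z_uniq j).
  - by case: u => // wb; rewrite wb bB in wB.
  - by case: t => // wb; rewrite -wb bB in wB.
  - by case: t; case: u => // E _ _ _; [rewrite (b_inj _ _ (inv_inj mateK E)) | rewrite (b_inj _ _ E)].
apply: (giso_of_inj g_inj) => [|p q]; first by rewrite card_U cardG.
rewrite max_deg_edge !g_c !g_N g_mu (inj_eq g_inj) /= /sym_rel.
case: p q => [[[[|[|[|i]]] Hi]|i]|[k t]] [[[[|[|[|j]]] Hj]|j]|[l u]] //=; rewrite ?andbF ?andbT ?orbF ?orbT //=.
- by rewrite -[LHS]/(Ordinal Hj == inord 2) -val_eqE /= inordK.
- by rewrite -[LHS]/(Ordinal Hj == inord 2) -val_eqE /= inordK.
- by rewrite -[LHS]/(Ordinal Hj == inord 1) -val_eqE /= inordK.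
- by rewrite -[LHS]/(Ordinal Hj == inord 1) -val_eqE /= inordK.
rewrite -[LHS]/((l, u) == (k, ~~ t)) -[inr _ == _]/((k, t) == (l, u)) !xpair_eqE.
by rewrite (eq_sym l); case: eqVneq; case: t; case: u.
Qed.

End Vertex.
End Matched.
End Unicyclic.

(** * Deleting a pendant path of length two *)

Definition matched_unicyclic (m : nat) (G : sgraph) :=
  [/\ connected_graph G, #|G| = 2 * m, \sum_(v : G) deg v = 4 * m
    & exists mate : G -> G, perfect_mate mate].

Section Induced.

Variables (G : sgraph) (S : {set G}).

Definition induced_edge : rel {x in S} := fun x y => sedge (val x) (val y).

Lemma induced_edge_sym : symmetric induced_edge.
Proof. by move=> x y; apply: sedge_sym. Qed.

Lemma induced_edge_irrefl : irreflexive induced_edge.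
Proof. by move=> x; apply: sedge_irrefl. Qed.

Definition induced := SGraph induced_edge_sym induced_edge_irrefl.

End Induced.

Section PendantPath.

Variables (G : sgraph) (m : nat) (b a c : G).
Hypotheses (m_ge5 : 5 <= m) (GP : matched_unicyclic m G).
Hypotheses (ba : sedge b a) (b1 : deg b = 1) (a2 : deg a = 2).
Hypotheses (ac : sedge a c) (cb : c != b).

Let S := ~: [set a; b].
Let H := induced S.

Let G_conn : connected_graph G. Proof. by case: GP. Qed.
Let cardG : #|G| = 2 * m. Proof. by case: GP. Qed.
Let sum_degG : \sum_(v : G) deg v = 4 * m. Proof. by case: GP. Qed.

Let nbr_b u : sedge b u = (u == a). Proof. exact: leaf_nbr. Qed.

Let nbr_a u : sedge a u = (u == b) || (u == c).
Proof.
have /setP/(_ u) : [set b; c] = [set u | sedge a u]; last by rewrite !inE.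
apply/eqP; rewrite eqEcard cards2 eq_sym cb -/(deg a) a2 andbT.
by apply/subsetP => v; rewrite !inE => /orP[]/eqP->; rewrite // sedge_sym.
Qed.

Let ab : a != b.
Proof. by apply: contraTneq ba => ->; rewrite sedge_irrefl. Qed.

Let inS v : (v \in S) = (v != a) && (v != b).
Proof. by rewrite !inE negb_or. Qed.

Let cS : c \in S.
Proof. by rewrite inS cb andbT; apply: contraTneq ac => ->; rewrite sedge_irrefl. Qed.

Let cH : H := Sub c cS.

Let dist_a v : v \in S -> dist a v = (dist c v).+1.
Proof.
rewrite inS => /andP[va vb].
have [w wa E] := dist_pred G_conn va.
rewrite sedge_sym nbr_a in wa.
case/orP: wa E => /eqP->; rewrite (dist_symm G_conn v a) (dist_symm G_conn v) //.
by rewrite (leaf_dist G_conn ba b1 vb) => /eqP; rewrite eqn_leq ltnNge leqnSn andbF.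
Qed.

Let dist_b v : v \in S -> dist b v = (dist c v).+2.
Proof.
move=> vS; rewrite (leaf_dist G_conn ba b1) ?dist_a //.
by move: vS; rewrite inS => /andP[].
Qed.

(** A geodesic between surviving vertices avoids [a] and [b]: the only neighbour of [b] is deleted,
    and a last step from [a] would enter [c], which is closer to [x] than [a] is. *)
Let induced_path n (x y : H) : dist (val x) (val y) = n ->
  exists p, [/\ path (@sedge H) x p, last x p = y & size p = n].
Proof.
elim: n y => [|n IHn] y E.
  exists [::]; split=> //=; apply/val_inj/eqP.
  by rewrite -(dist_eq0 G_conn) E.
have xy : val x != val y by rewrite -(dist_gt0 G_conn) E.
have [w wy Ew] := dist_pred G_conn xy.
have wS : w \in S.
  rewrite inS; apply/andP; split; apply: contraTneq wy => Ew'; subst w.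
    rewrite nbr_a; apply/negP => /orP[]/eqP Ey.
      by have := valP y; rewrite /= inS Ey eqxx andbF.
    have := dist_a (valP x); rewrite (dist_symm G_conn a) (dist_symm G_conn c) -Ey.
    by move: Ew; lia.
  by rewrite nbr_b; apply: contraTneq (valP y) => ->; rewrite inS eqxx.
have [|p [pp lp sp]] := IHn (Sub w wS); first by apply: succn_inj; rewrite -Ew.
exists (rcons p y); rewrite rcons_path last_rcons size_rcons sp pp lp; split=> //.
Qed.

Let H_conn : connected_graph H.
Proof.
apply/andP; split; first by apply/card_gt0P; exists cH.
apply/forallP => x; apply/forallP => y; apply/connectP.
by have [p [? ? _]] := induced_path (erefl (dist (val x) (val y))); exists p.
Qed.

Let dist_H (x y : H) : dist x y = dist (val x) (val y).
Proof.
apply/eqP; rewrite eqn_leq; apply/andP; split.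
  have [p [pp lp sp]] := induced_path (erefl (dist (val x) (val y))).
  by rewrite -sp -lp; apply: dist_le_path.
have [p [pp <- <-]] := dist_pathE H_conn x y.
rewrite -(size_map val) -last_map; apply: dist_le_path.
by rewrite path_map.
Qed.

Let sum_split (F : G -> nat) :
  \sum_v F v = F a + F b + \sum_(x : H) F (val x).
Proof.
rewrite (bigD1 a) //= (bigD1 b) 1?eq_sym //= addnA; congr (_ + _).
rewrite -[RHS](big_sub _ F); apply: eq_bigl => v; by rewrite inS.
Qed.

Let cardH : #|H| = 2 * (m - 1).
Proof.
have : #|G| = 1 + 1 + #|H| by rewrite -!sum1_card; apply: (sum_split (fun=> 1)).
by rewrite cardG; move: #|H| => n; lia.
Qed.

Let deg_H (x : H) : deg (val x) = deg x + (x == cH).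
Proof.
rewrite /deg (cardsD1 a) inE sedge_sym nbr_a addnC -val_eqE /=.
have -> : (val x == b) = false by have := valP x; rewrite inS => /andP[_ /negbTE].
congr (_ + _); rewrite -[RHS](card_imset _ val_inj); apply: eq_card => u.
rewrite !inE; apply/andP/imsetP => [[ua xu]|[y]].
  have uS : u \in S.
    rewrite inS ua; apply: contraTneq xu => ->; rewrite sedge_sym nbr_b.
    by apply/eqP => xa; have := valP x; rewrite /= inS xa eqxx.
  by exists (Sub u uS) => //; rewrite inE.
rewrite inE => xy ->; split=> //.
by have := valP y; rewrite /= inS => /andP[].
Qed.

(** The degree sum drops by 4: 2 at [a], 1 at [b], 1 at [c]. The matching restricts because [b] can
    only be matched with [a]. *)
Lemma matched_unicyclic_del : matched_unicyclic m.-1 H.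
Proof.
rewrite -subn1; split=> //.
  have := sum_split (@deg G); rewrite sum_degG a2 b1.
  under [X in _ + X]eq_bigr do rewrite deg_H.
  have one : \sum_(x : H) (x == cH) = 1.
    by rewrite (bigD1 cH) //= eqxx big1 => // x /negbTE->.
  by rewrite big_split /= one; lia.
have [_ _ _ [mate [mateK mate_edge]]] := GP.
have mate_b : mate b = a by apply/eqP; rewrite -nbr_b.
have mate_a : mate a = b by rewrite -mate_b mateK.
have mateS v : v \in S -> mate v \in S.
  rewrite !inS -(inj_eq (inv_inj mateK)) -[v == b](inj_eq (inv_inj mateK)).
  by rewrite mate_b mate_a andbC.
exists (fun x => Sub (mate (val x)) (mateS _ (valP x))).
split=> [x|x]; last exact: mate_edge.
by apply: val_inj; rewrite /= mateK.
Qed.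

Lemma deg_del : deg c = (deg (cH : H)).+1.
Proof. by rewrite -[c]/(val cH) deg_H eqxx addn1. Qed.

(** With [k] the degree of [c] in [H], the old vertices gain at least [84 (m - 1) - 36 - 20 k] (less
    what is charged to [a] and [b]), and these two supply the rest, including [22 (m - 1) + 7]. The
    total [106 m - 135 - 20 k] is regrouped using [deg c = k + 1]. *)
Lemma ecc_dist_sum_del :
  ecc_dist_sum H + (86 * m - 135) + 20 * (m.+1 - deg c) <= ecc_dist_sum G.
Proof.
(* The degree bound in [H]. It makes the truncated [m.+1 - deg c] a true difference, and it leaves
   some vertex [x0] at distance at least 2 from [c], which forces the eccentricities of [a] and
   [b]. *)
have le_k : deg (cH : H) <= m.
  have [_ cardH' sum_degH [mate mateP]] := matched_unicyclic_del.
  by have := deg_le H_conn cardH' sum_degH mateP cH; rewrite prednK //; lia.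
have [x0 x0_far] : exists x : H, 2 <= dist cH x.
  apply/existsP; rewrite -[X in is_true X]negbK negb_exists; apply/negP => /forallP near.
  have : #|H| <= #|cH |: [set x | sedge cH x]|.
    apply/subset_leq_card/subsetP => x _; rewrite in_setU1 inE eq_sym.
    by rewrite -dist_le1 // leqNgt near.
  by rewrite cardsU1 -/(deg (cH : H)) cardH; lia.
have sum_c : \sum_(x : H) (x == cH) = 1.
  by rewrite (bigD1 cH) //= eqxx big1 => // x /negbTE->.
have sum_k : \sum_(x : H) sedge cH x = deg (cH : H).
  rewrite /deg -sum1_card [RHS]big_mkcond; apply: eq_bigr => x _.
  by rewrite inE; case: (sedge cH x).
have sum_const k : \sum_(x : H) k = 2 * (m - 1) * k by rewrite sum_nat_const cardH.
have distc x : dist cH x = dist c (val x) by rewrite dist_H.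
pose d (x : H) := dist cH x.
(* The distance sum gains [d + 1] from [a] and [d + 2] from [b]; the new eccentricity is at least
   the old one (used on the old sum) and at least [d + 2] (used on the gain). *)
have local (x : H) : eccentricity x * dist_sum x + (d x + 2) * (2 * d x + 3)
    <= eccentricity (val x) * dist_sum (val x).
  have -> : dist_sum (val x) = dist_sum x + (2 * d x + 3).
    rewrite /dist_sum sum_split dist_a ?dist_b ?(valP x) // -distc -/(d x).
    by rewrite (eq_bigr (fun y => dist y x)) => [|y _]; [lia | rewrite dist_H].
  have e1 : eccentricity x <= eccentricity (val x).
    by apply: ecc_le => // y; rewrite dist_H; apply: dist_le_ecc.
  have e2 : d x + 2 <= eccentricity (val x).
    rewrite addn2 /d distc -dist_b ?(valP x) // dist_symm //; exact: dist_le_ecc.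
  by rewrite [in leqRHS]mulnDr leq_add // leq_mul.
(* The vertex [x] pays [(d + 2) * (2 * d + 3)] itself and [3 * d + 4 * d] through
   the distance sums of [a] and [b], whose eccentricities are at least 3 and 4:
   in total 6 at [c], 22 at a neighbour of [c], and at least 42 elsewhere. *)
have shell (x : H) :
    42 <= (d x + 2) * (2 * d x + 3) + 7 * d x + 36 * (x == cH) + 20 * sedge cH x.
  rewrite eq_sym -(dist_eq0 H_conn) -/(d x).
  have := dist_le1 H_conn cH x; rewrite -(dist_eq0 H_conn) -/(d x).
  by case: (d x) => [|[|k]] /=; [| move=> <- |]; lia.
have Da : dist_sum a = 1 + 2 * (m - 1) + \sum_x d x.
  rewrite dist_sum_symm // sum_split distxx dist_edge 1?sedge_sym //.
  under eq_bigr => x _ do rewrite dist_a ?(valP x) // -distc -/(d x) -addn1.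
  by rewrite big_split /= sum_const; lia.
have Db : dist_sum b = 1 + 4 * (m - 1) + \sum_x d x.
  rewrite dist_sum_symm // sum_split distxx dist_edge //.
  under eq_bigr => x _ do rewrite dist_b ?(valP x) // -distc -/(d x) -addn2.
  by rewrite big_split /= sum_const; lia.
have ea : 3 <= eccentricity a.
  apply: leq_trans (dist_le_ecc G_conn (val x0) a).
  by rewrite dist_a ?(valP x0) // -distc.
have eb : 4 <= eccentricity b.
  apply: leq_trans (dist_le_ecc G_conn (val x0) b).
  by rewrite dist_b ?(valP x0) // -distc.
rewrite deg_del /ecc_dist_sum sum_split.
have Hsum : \sum_(x : H) eccentricity x * dist_sum x + \sum_x (d x + 2) * (2 * d x + 3)
    <= \sum_(x : H) eccentricity (val x) * dist_sum (val x).
  by rewrite -big_split /=; apply: leq_sum => x _; apply: local.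
have Hshell : 2 * (m - 1) * 42 <= \sum_x (d x + 2) * (2 * d x + 3)
    + 7 * \sum_x d x + 36 + 20 * deg (cH : H).
  rewrite -sum_const; apply: leq_trans; first by apply: leq_sum => x _; apply: shell.
  have distr k (F : H -> nat) : \sum_x k * F x = k * \sum_x F x by rewrite big_distrr.
  by rewrite 3!big_split /= !distr sum_c sum_k muln1.
have Ha := leq_mul ea (leqnn (dist_sum a)).
have Hb := leq_mul eb (leqnn (dist_sum b)).
rewrite Da Db in Ha Hb *; lia.
Qed.

End PendantPath.

(** * Cycles with pendant vertices *)

Section CycleWithPendants.

Variables (G : sgraph) (m : nat) (mate : G -> G).
Implicit Types u v w x l : G.
Hypotheses (m_ge5 : 5 <= m) (GP : matched_unicyclic m G).
Hypothesis mateP : perfect_mate mate.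
Hypothesis no_pendant_path : forall l, deg l = 1 -> deg (mate l) != 2.

Let G_conn : connected_graph G. Proof. by case: GP. Qed.
Let cardG : #|G| = 2 * m. Proof. by case: GP. Qed.
Let sum_degG : \sum_(v : G) deg v = 4 * m. Proof. by case: GP. Qed.
Let mateK : involutive mate. Proof. by case: mateP. Qed.
Let mate_edge v : sedge v (mate v). Proof. by case: mateP. Qed.

Let leaf (v : G) := deg v == 1.

Let leaf_nbr_mate l u : leaf l -> sedge l u = (u == mate l).
Proof. by move/eqP=> l1; apply: (leaf_nbr (mate_edge l) l1). Qed.

Let dist_leaf l u : leaf l -> u != l -> dist l u = (dist (mate l) u).+1.
Proof. by move/eqP=> l1; apply: (leaf_dist G_conn (mate_edge l) l1). Qed.

Let deg_gt0 v : 0 < deg v.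
Proof. by apply/card_gt0P; exists (mate v); rewrite inE. Qed.

(** Degree 2 is excluded by hypothesis. If both partners were leaves, each would be one step farther
    than the other from any third vertex. *)
Let leaf_mate_deg l : leaf l -> 3 <= deg (mate l).
Proof.
move=> ll; have : ~~ leaf (mate l).
  apply/negP => lml.
  have [u] : exists u, u \notin [set l; mate l].
    apply/existsP; rewrite -negb_forall; apply/negP => /forallP all_in.
    have : #|G| <= #|[set l; mate l]|.
      by apply/subset_leq_card/subsetP => u _; apply: all_in.
    by rewrite cards2 cardG; move: m_ge5; lia.
  rewrite !inE negb_or => /andP[ul um].
  by have := dist_leaf ll ul; rewrite (dist_leaf lml um) mateK; lia.
have := no_pendant_path (eqP ll); have := deg_gt0 (mate l).
by rewrite /leaf; case: (deg _) => [|[|[|]]].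
Qed.

Let mate_leaf_core l : leaf l -> ~~ leaf (mate l).
Proof. by move/leaf_mate_deg; apply: contraTN => /eqP->. Qed.

(* The two sides have the same sum over the graph, and [>=] holds at every
   vertex. *)
Let deg_eq v : deg v + leaf v = 2 + leaf (mate v).
Proof.
have le_v u : 2 + leaf (mate u) <= deg u + leaf u.
  case: (boolP (leaf u)) => [lu|]; first by rewrite (negbTE (mate_leaf_core lu)) (eqP lu).
  case: (boolP (leaf (mate u))) => [/leaf_mate_deg|_]; first by rewrite mateK addn0.
  by have := deg_gt0 u; rewrite /leaf; case: (deg u) => [|[|]].
have sum_leaf : \sum_u leaf (mate u) = \sum_u leaf u.
  by rewrite [RHS](reindex_inj (inv_inj mateK)).
have : \sum_u (deg u + leaf u) = \sum_u (2 + leaf (mate u)).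
  by rewrite !big_split /= sum_degG sum_leaf sum_nat_const cardG; lia.
rewrite (bigD1 v) //= [RHS](bigD1 v) //= => E.
have : \sum_(u | u != v) (2 + leaf (mate u)) <= \sum_(u | u != v) (deg u + leaf u).
  by apply: leq_sum.
by have := le_v v; lia.
Qed.

(** The only possible leaf at [v] is its partner, and [deg_eq] counts precisely that leaf beyond 2.
    So the non-leaves form the cycle. *)
Let core_nbrs v : ~~ leaf v -> #|[set u | sedge v u && ~~ leaf u]| = 2.
Proof.
move=> cv; have := deg_eq v; rewrite (negbTE cv) addn0 /deg.
rewrite -(cardsID [set u | leaf u]).
have -> : [set u | sedge v u] :&: [set u | leaf u] =
          if leaf (mate v) then [set mate v] else set0.
  apply/setP=> u; rewrite !inE; apply/andP/idP => [[vu lu]|].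
    have Ev : v = mate u by apply/eqP; rewrite -leaf_nbr_mate // sedge_sym.
    by rewrite Ev mateK lu inE eqxx.
  by case: ifP => lmv; rewrite inE // => /eqP->.
have -> : [set u | sedge v u] :\: [set u | leaf u] = [set u | sedge v u && ~~ leaf u].
  by apply/setP=> u; rewrite !inE andbC.
by case: (leaf _); rewrite ?cards1 ?cards0; lia.
Qed.

(** * Growth of balls around a cycle vertex *)

Section FromCore.

Variables (v : G) (cv : ~~ leaf v).

Let shell k := [set u | ~~ leaf u & dist v u == k].

(* A second successor of [w] in the next shell would be a third core neighbour,
   besides the parent of [w]. *)
Let card_shell k : #|shell k.+1| <= 2.
Proof.
elim: k => [|k IHk].
  rewrite -(core_nbrs cv); apply/subset_leq_card/subsetP => u.
  rewrite !inE => /andP[-> /eqP d1]; rewrite andbT.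
  have := dist_le1 G_conn v u; rewrite -(dist_eq0 G_conn) d1 /=.
  by move/esym.
have [par parP] := bfs_parent v G_conn.
have par_core u : u != v -> ~~ leaf u -> ~~ leaf (par u).
  move=> uv cu; have [up E] := parP _ uv; apply/negP => lp.
  have Ep : u = mate (par u) by apply/eqP; rewrite -leaf_nbr_mate // sedge_sym.
  have := @dist_leaf (par u) v lp; rewrite -Ep (dist_symm G_conn _ v) (dist_symm G_conn u v).
  by case: eqVneq => [Ev|_ /(_ isT)]; [move: cv; rewrite Ev lp | lia].
have neq_v k' u : u \in shell k'.+1 -> u != v.
  by rewrite inE => /andP[_ /eqP d]; rewrite eq_sym -(dist_gt0 G_conn) d.
apply: leq_trans IHk; rewrite -(card_in_imset (f := par) (D := shell k.+2)).
  apply/subset_leq_card/subsetP => _ /imsetP[u uS ->].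
  have uv := neq_v _ _ uS; have [_ E] := parP _ uv.
  move: uS; rewrite !inE => /andP[cu /eqP d]; rewrite par_core //=.
  by move: E; rewrite d => -[<-].
move=> u u' uS uS' Epar; apply/eqP; apply: contraT => uu'.
have uv := neq_v _ _ uS; have uv' := neq_v _ _ uS'.
have [up E] := parP _ uv; have [up' E'] := parP _ uv'.
move: uS uS'; rewrite !inE => /andP[cu /eqP d] /andP[cu' /eqP d'].
set w := par u in Epar up E; rewrite -Epar in up' E'.
have dw : dist v w = k.+1 by apply: succn_inj; rewrite -E d.
have wv : w != v by rewrite eq_sym -(dist_gt0 G_conn) dw.
have cw : ~~ leaf w by apply: par_core.
have [wp Ew] := parP _ wv; have cpw := par_core _ wv cw.
have dp : dist v (par w) = k by apply: succn_inj; rewrite -Ew dw.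
have : #|[set par w; u; u']| <= #|[set x | sedge w x && ~~ leaf x]|.
  apply/subset_leq_card/subsetP => x; rewrite !inE => /orP[/orP[]|] /eqP->.
  - by rewrite wp cpw.
  - by rewrite sedge_sym up cu.
  - by rewrite sedge_sym up' cu'.
have neq_p x : dist v x = k.+2 -> par w != x.
  by move=> dx; apply/eqP => px; move: dp; rewrite px dx; clear; lia.
rewrite (core_nbrs cw) setUC cardsU1 cards2 !inE negb_or.
by rewrite (eq_sym u' (par w)) (eq_sym u' u) !neq_p // uu'.
Qed.

Let core_ball k := [set u | ~~ leaf u & dist v u <= k].

Let card_core_ball k : #|core_ball k| <= 2 * k + 1.
Proof.
elim: k => [|k IHk].
  rewrite muln0 -(cards1 v); apply/subset_leq_card/subsetP => u.
  by rewrite !inE leqn0 dist_eq0 // eq_sym => /andP[].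
have : core_ball k.+1 \subset core_ball k :|: shell k.+1.
  apply/subsetP => u; rewrite !inE leq_eqVlt ltnS.
  by case/andP=> -> /orP[] ->; rewrite ?orbT.
move/subset_leq_card/leq_trans; apply.
apply: leq_trans (leq_card_setU _ _) _.
by have := card_shell k; lia.
Qed.

(** A leaf within [k + 1] hangs at a cycle vertex within [k]; if [v] carries no leaf, [v] itself is
    missed by this injection, which saves one. *)
Let card_leaf_ball k :
  #|[set u | leaf u & dist v u <= k.+1]| + ~~ leaf (mate v) <= 2 * k + 1.
Proof.
apply: leq_trans (card_core_ball k).
rewrite -(card_imset _ (inv_inj mateK)) (cardsD1 v (core_ball k)).
have -> : v \in core_ball k by rewrite inE cv distxx.
rewrite addnC.
have sub : mate @: [set u | leaf u & dist v u <= k.+1] \subset core_ball k.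
  apply/subsetP => x /imsetP[u]; rewrite inE => /andP[lu du] ->{x}.
  rewrite inE mate_leaf_core //=; move: du.
  rewrite (dist_symm G_conn v u) dist_leaf ?(dist_symm G_conn v) //.
  by apply: contraNneq cv => ->.
case: (boolP (leaf (mate v))) => [_|cmv].
  by apply: leq_trans (subset_leq_card sub) _; rewrite (cardsD1 v); case: (v \in _).
rewrite leq_add2l; apply/subset_leq_card/subsetP => x xI.
rewrite in_setD1 (subsetP sub) // andbT; apply: contraNneq cmv => <-.
by case/imsetP: xI => u; rewrite inE => /andP[lu _] ->; rewrite mateK.
Qed.

Let far_ball k : 2 * m + ~~ leaf (mate v) <= far k.+1 v + 4 * k.+1.
Proof.
rewrite -cardG -(ball_far k.+1 v).
rewrite -(cardsID [set u | leaf u] [set u | dist v u <= k.+1]).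
have -> : [set u | dist v u <= k.+1] :&: [set u | leaf u]
          = [set u | leaf u & dist v u <= k.+1].
  by apply/setP => u; rewrite !inE andbC.
have -> : [set u | dist v u <= k.+1] :\: [set u | leaf u] = core_ball k.+1.
  by apply/setP => u; rewrite !inE.
by have := card_leaf_ball k; have := card_core_ball k.+1; lia.
Qed.

(** The first three tails are at least [2m - 1], [2m - 4] and [2m - 8], the last two being one
    larger when [v] carries no leaf. *)
Lemma core_dist_sum : 6 * m - 13 + 2 * ~~ leaf (mate v) <= dist_sum v.
Proof.
apply: leq_trans (sum_far_le G_conn 3 v).
rewrite !big_ord_recl big_ord0 /=.
have far0 : far 0 v = 2 * m - 1.
  have := ball_far 0 v; rewrite cardG.
  have -> : [set u | dist v u <= 0] = [set v].
    by apply/setP => u; rewrite !inE leqn0 dist_eq0 // eq_sym.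
  by rewrite cards1; lia.
have := far_ball 0; have := far_ball 1; rewrite /= far0 /bump /= -[1 + 0]/1 -[1 + 1]/2; lia.
Qed.

Lemma core_ecc_ge3 : 3 <= eccentricity v.
Proof. by rewrite -far_gt0 //; have := far_ball 1; lia. Qed.

(** A ball of radius 3 has at most 12 vertices, at most 7 of them on the cycle. *)
Lemma core_ecc_ge4 : 7 <= m \/ 8 <= #|[set u | ~~ leaf u]| -> 4 <= eccentricity v.
Proof.
case=> [m7|c8]; first by rewrite -far_gt0 //; have := far_ball 2; lia.
rewrite leqNgt; apply/negP => ecc3.
suff : #|[set u | ~~ leaf u]| <= #|core_ball 3| by have := card_core_ball 3; lia.
apply/subset_leq_card/subsetP => u; rewrite !inE => -> /=.
by apply: leq_trans (dist_le_ecc G_conn u v) _.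
Qed.

End FromCore.

Let p := #|[set u | leaf u]|.

Let card_core : p + #|[set u | ~~ leaf u]| = 2 * m.
Proof.
rewrite -cardG -(cardsC [set u | leaf u]); congr (_ + _).
by apply: eq_card => u; rewrite !inE.
Qed.

Let sum_indicator (P : pred G) : \sum_v (P v : nat) = #|[set v | P v]|.
Proof.
by rewrite -sum1_card [RHS]big_mkcond; apply: eq_bigr => v _; rewrite inE; case: (P v).
Qed.

Let card_unleafed : #|[set v | ~~ leaf v & ~~ leaf (mate v)]| + 2 * p = 2 * m.
Proof.
have Ep : #|[set v | leaf (mate v)]| = p.
  rewrite /p -(card_imset [set u | leaf u] (inv_inj mateK)); apply: eq_card => v.
  rewrite inE; apply/idP/imsetP => [lmv|[u]]; first by exists (mate v); rewrite ?inE ?mateK.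
  by rewrite inE => lu ->; rewrite mateK.
rewrite mul2n -addnn -{1}Ep /p -!sum_indicator -!big_split /= -cardG -sum1_card.
apply: eq_bigr => v _.
case: (boolP (leaf v)) => [/mate_leaf_core/negbTE->//|_].
by case: (leaf (mate v)).
Qed.

Let leaf_bounds l : leaf l ->
  eccentricity (mate l) < eccentricity l /\ dist_sum l = dist_sum (mate l) + (2 * m - 2).
Proof.
move=> ll; rewrite -cardG; split.
  apply: leaf_ecc => //; first exact: eqP.
  by apply: leq_trans (core_ecc_ge3 (mate_leaf_core ll)).
by apply: leaf_dist_sum => //; [exact: eqP | rewrite cardG; lia].
Qed.

Lemma ecc_dist_sum_no_pendant_path : 43 * m ^ 2 - 92 * m + 57 < ecc_dist_sum G.
Proof.
(* With all eccentricities at least 4, the uniform bound [48 m^2 - 104 m] already exceeds the target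
   for [m >= 5]. What remains is [m = 5] or [m = 6] with a cycle of length at most 7. *)
case: (boolP ((7 <= m) || (8 <= #|[set u | ~~ leaf u]|))) => [/orP big|].
  have bound (v : G) : 4 * (6 * m - 13) <= eccentricity v * dist_sum v.
    case: (boolP (leaf v)) => lv; last first.
      rewrite leq_mul ?core_ecc_ge4 //.
      by apply: leq_trans (core_dist_sum lv); rewrite leq_addr.
    have cmv := mate_leaf_core lv; have [le1 ->] := leaf_bounds lv.
    rewrite leq_mul //; first by have := core_ecc_ge4 cmv big; lia.
    by have := core_dist_sum cmv; lia.
  have : 2 * m * (4 * (6 * m - 13)) <= ecc_dist_sum G.
    by rewrite -cardG -sum_nat_const; apply: leq_sum.
  by move: m_ge5; nia.
rewrite negb_or -!ltnNge => /andP[m7 c8].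
(* The extra 6 for a leafless cycle vertex matters: for [m = 5] and three leaves the total is 657
   without it and 681 with it, against 672. *)
have bound (v : G) :
  3 * (6 * m - 13) * ~~ leaf v + 6 * (~~ leaf v && ~~ leaf (mate v))
    + 4 * (8 * m - 15) * leaf v <= eccentricity v * dist_sum v.
  case: (boolP (leaf v)) => lv /=; last first.
    have := leq_mul (core_ecc_ge3 lv) (core_dist_sum lv); lia.
  have cmv := mate_leaf_core lv; have [le1 ->] := leaf_bounds lv.
  have e4 : 4 <= eccentricity v by have := core_ecc_ge3 cmv; lia.
  have D : 8 * m - 15 <= dist_sum (mate v) + (2 * m - 2).
    by have := core_dist_sum cmv; lia.
  by have := leq_mul e4 D; lia.
have : 3 * (6 * m - 13) * #|[set u | ~~ leaf u]|
   + 6 * #|[set v | ~~ leaf v & ~~ leaf (mate v)]| + 4 * (8 * m - 15) * p <= ecc_dist_sum G.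
  rewrite /p -!sum_indicator !big_distrr /= -!big_split /=.
  by apply: leq_sum => v _; apply: bound.
have := card_core; have := card_unleafed.
have [-> | ->] : m = 5 \/ m = 6 by move: m_ge5 m7; lia.
  by move: c8; lia.
by move: c8; lia.
Qed.

End CycleWithPendants.

(** * Computing with labelled graphs *)

Definition nbrs_of (n : nat) (arcs : seq (nat * nat)) : seq (seq nat) :=
  mkseq (fun j => [seq i <- iota 0 n | (i, j) \in arcs]) n.

Definition grow (nbrs : seq (seq nat)) (B : bitseq) : bitseq :=
  mkseq (fun j => nth false B j || has (nth false B) (nth [::] nbrs j)) (size nbrs).

(* Entry [k] counts the vertices at distance more than [k] from [i]. *)
Definition far_profile (nbrs : seq (seq nat)) (i : nat) : seq nat :=
  let n := size nbrs in
  [seq n - count id B | B <- traject (grow nbrs) (mkseq (pred1 i) n) n].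

(** The factor [count (leq 1) d] is the eccentricity, since the tails are nonzero exactly below
    it. *)
Definition xi_nbrs (nbrs : seq (seq nat)) : nat :=
  sumn [seq (let d := far_profile nbrs i in count (leq 1) d * sumn d)
       | i <- iota 0 (size nbrs)].

Lemma ball_succ (G : sgraph) k (u v : G) : connected_graph G ->
  (dist u v <= k.+1) = (dist u v <= k) || [exists w, sedge w v && (dist u w <= k)].
Proof.
move=> G_conn.
apply/idP/orP => [|[|/existsP[w /andP[wv]]]].
- rewrite leq_eqVlt ltnS => /orP[/eqP d|]; [right | by left].
  have [|w wv E] := @dist_pred _ G_conn u v; first by rewrite -(dist_gt0 G_conn) d.
  by apply/existsP; exists w; rewrite wv -ltnS -E d leqnn.
- exact: leqW.
- by move=> d; apply: leq_trans (dist_edge_lipschitz G_conn u wv) _.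
Qed.

Section Labelled.

Variables (G : sgraph) (x0 : G) (s : seq G) (arcs : seq (nat * nat)).
Let n := #|G|.
Hypotheses (G_conn : connected_graph G) (s_uniq : uniq s) (size_s : size s = n).
Hypothesis arcsP : forall i j, i < n -> j < n ->
  sedge (nth x0 s i) (nth x0 s j) = ((i, j) \in arcs).

Let nbrs := nbrs_of n arcs.

Let size_nbrs : size nbrs = n. Proof. by rewrite size_mkseq. Qed.

Lemma mem_labels v : v \in s.
Proof.
have [|_ E] := uniq_min_size s_uniq (s2 := enum G) (fun u _ => mem_enum _ u).
  by rewrite -cardE size_s.
by rewrite E mem_enum.
Qed.

Let nth_s_ex v : exists2 i, i < n & v = nth x0 s i.
Proof.
by exists (index v s); rewrite ?nth_index ?mem_labels // -size_s index_mem mem_labels.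
Qed.

Lemma sum_labels (F : G -> nat) : \sum_v F v = \sum_(i <- iota 0 n) F (nth x0 s i).
Proof.
rewrite -(big_map (nth x0 s) xpredT F) -[X in iota 0 X]size_s -/(mkseq (nth x0 s) _).
rewrite mkseq_nth [RHS]big_uniq //=; apply: eq_bigl => v.
by rewrite mem_labels.
Qed.

Lemma card_labels (P : pred G) :
  #|[set v | P v]| = count (fun i => P (nth x0 s i)) (iota 0 n).
Proof.
rewrite -sum1dep_card big_mkcond sum_labels -sum1_count [RHS]big_mkcond.
by apply: eq_bigr => i _; case: ifP.
Qed.

Lemma iter_grow k i : i < n ->
  iter k (grow nbrs) (mkseq (pred1 i) n)
    = mkseq (fun j => dist (nth x0 s i) (nth x0 s j) <= k) n.
Proof.
move=> lt_i; elim: k => [|k IHk] /=.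
  apply: (@eq_from_nth _ false); rewrite !size_mkseq // => j lt_j.
  by rewrite !nth_mkseq //= leqn0 dist_eq0 // nth_uniq ?size_s // eq_sym.
rewrite {}IHk /grow size_nbrs; apply: (@eq_from_nth _ false); rewrite !size_mkseq // => j lt_j.
rewrite !nth_mkseq // ball_succ //; apply: (congr1 (orb _)).
apply/hasP/existsP => [[l]|[w /andP[]]].
  rewrite mem_filter mem_iota => /andP[lj /= lt_l]; rewrite nth_mkseq // => d.
  by exists (nth x0 s l); rewrite d arcsP // lj.
have [l lt_l ->] := nth_s_ex w; rewrite arcsP // => lj d.
by exists l; [rewrite mem_filter lj mem_iota | rewrite nth_mkseq].
Qed.

Lemma far_profileE i : i < n ->
  far_profile nbrs i = mkseq (fun k => far k (nth x0 s i)) n.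
Proof.
move=> lt_i; rewrite /far_profile size_nbrs.
apply: (@eq_from_nth _ 0); rewrite size_map size_traject ?size_mkseq // => k lt_k.
rewrite (nth_map (mkseq (pred1 i) n)) ?size_traject // nth_traject // iter_grow // nth_mkseq //.
have := ball_far k (nth x0 s i); rewrite card_labels /mkseq count_map.
rewrite -/n => E; rewrite -[X in X - _]E; exact: addKn.
Qed.

Lemma ecc_dist_sum_labelled : ecc_dist_sum G = xi_nbrs nbrs.
Proof.
have sum_seq (F : nat -> nat) : \sum_(k < n) F k = sumn (mkseq F n).
  by rewrite -(big_mkord xpredT) sumnE big_map /index_iota subn0.
rewrite /ecc_dist_sum sum_labels /xi_nbrs size_nbrs sumnE big_map.
apply: eq_big_seq => i; rewrite mem_iota => /andP[_ lt_i].
rewrite far_profileE //; congr (_ * _).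
  by rewrite eccE // (sum_seq (fun k => nat_of_bool (0 < far k _))) -sumn_count -map_comp.
by rewrite dist_sumE // (sum_seq (fun k => far k _)).
Qed.

Lemma deg_labelled j : j < n -> deg (nth x0 s j) = size (nth [::] nbrs j).
Proof.
move=> lt_j; rewrite /deg card_labels nth_mkseq // size_filter.
apply: eq_in_count => i; rewrite mem_iota => /andP[_ lt_i].
by rewrite sedge_sym arcsP.
Qed.

End Labelled.

(** * Numeric labels for the exceptional graph *)

Definition C5_111_arcs : seq (nat * nat) :=
  let e := [:: (0, 1); (1, 2); (2, 3); (3, 4); (4, 0); (0, 5); (1, 6); (2, 7)] in
  e ++ [seq (p.2, p.1) | p <- e].

Definition C5_111_code (z : C5_111) : nat :=
  match z with inl i => i | inr k => 5 + k end.

Definition C5_111_vertex (i : nat) : C5_111 :=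
  if i < 5 then inl (inord i) else inr (inord (i - 5)).

Lemma C5_111_vertexK i : i < 8 -> C5_111_code (C5_111_vertex i) = i.
Proof.
rewrite /C5_111_vertex; case: (ltnP i 5) => [lt5 _|ge5 lt8]; first exact: inordK.
by rewrite /C5_111_code inordK; lia.
Qed.

Lemma C5_111_codeK : cancel C5_111_code C5_111_vertex.
Proof.
rewrite /C5_111_vertex => -[] i; rewrite /C5_111_code; first by rewrite ltn_ord inord_val.
by rewrite ltnNge leq_addr addKn inord_val.
Qed.

Lemma C5_111_code_lt z : C5_111_code z < 8.
Proof. by case: z => i /=; have := ltn_ord i; lia. Qed.

Lemma C5_111_edge z t :
  sedge z t = ((C5_111_code z, C5_111_code t) \in C5_111_arcs).
Proof.
case: z => -[i lt_i]; case: t => -[j lt_j] /=;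
  do 5?[case: i lt_i => [|i] lt_i //]; do 5?[case: j lt_j => [|j] lt_j //].
Qed.

Lemma ecc_dist_sum_giso_C5_111 (G : sgraph) : connected_graph G ->
  giso G C5_111 -> ecc_dist_sum G = 373.
Proof.
move=> G_conn [f [g fK gK] fE].
have G8 : #|G| = 8.
  by rewrite (bij_eq_card (Bijective fK gK)) card_sum !card_ord.
pose s := mkseq (fun i => g (C5_111_vertex i)) 8.
rewrite (@ecc_dist_sum_labelled G (g (C5_111_vertex 0)) s C5_111_arcs) //.
- by rewrite G8.
- rewrite map_inj_in_uniq ?iota_uniq // => i j; rewrite !mem_iota /= => li lj.
  by move/(can_inj gK)/(congr1 C5_111_code); rewrite !C5_111_vertexK.
move=> i j; rewrite G8 => li lj; rewrite /s !nth_mkseq // -fE !gK C5_111_edge.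
by rewrite !C5_111_vertexK.
Qed.

(** * Eight vertices *)

Definition sym_arcs (es : seq (nat * nat)) := es ++ [seq (e.2, e.1) | e <- es].

(* The matching is [01, 23, 45, 67]; each pair after the first is attached to
   an earlier vertex by its even vertex, and by symmetry [2] is attached to [0]. *)
Definition matched_tree8 (p q : nat) :=
  [:: (0, 1); (2, 3); (0, 2); (4, 5); (p, 4); (6, 7); (q, 6)].

Definition iso_table (arcs : seq (nat * nat)) (t : seq nat) :=
  [&& size t == 8, uniq t, all (gtn 8) t &
    all (fun a => all (fun b =>
      ((nth 0 t a, nth 0 t b) \in arcs) == ((a, b) \in C5_111_arcs)) (iota 0 8)) (iota 0 8)].

(** Backtracking that drops a partial map at its first wrong adjacency. Its output is rechecked by
    [iso_table], so the search carries no correctness proof. *)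
Fixpoint partial_isos (arcs : seq (nat * nat)) (k : nat) : seq (seq nat) :=
  if k is k'.+1 then
    [seq rcons t x | t <- partial_isos arcs k',
       x <- [seq x <- iota 0 8 | (x \notin t) &&
               all (fun a => ((nth 0 t a, x) \in arcs) == ((a, k') \in C5_111_arcs)) (iota 0 k')]]
  else [:: [::]].

(* Conditionals rather than [||] and [&&]: [vm_compute] would evaluate both
   arguments of the latter, hence the search for isomorphisms on every graph. *)
Definition order8_check (arcs : seq (nat * nat)) :=
  let nbrs := nbrs_of 8 arcs in
  let xi := xi_nbrs nbrs in
  if 377 <= xi then true else if xi == 373 then
    all (fun l => size l <= 4) nbrs && has (iso_table arcs) (partial_isos arcs 8)
  else false.

Definition order8_edges := [seq (i, j) | i <- iota 0 8, j <- iota i.+1 (7 - i)].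

Lemma order8_checked :
  all (fun p => all (fun q => all (fun e =>
    if e \in matched_tree8 p q then true else order8_check (sym_arcs (e :: matched_tree8 p q)))
    order8_edges) (iota 0 6)) (iota 0 4).
Proof. by vm_compute. Qed.

Lemma crossing_edge (G : sgraph) (S : {pred G}) (x z : G) :
  connected_graph G -> x \in S -> z \notin S ->
  exists u v, [/\ u \in S, v \notin S & sedge u v].
Proof.
case/andP=> _ /forallP/(_ x)/forallP/(_ z) xz xS zS.
case: (boolP [exists u, exists v, [&& u \in S, v \notin S & sedge u v]]).
  by case/existsP=> u /existsP[v /and3P[? ? ?]]; exists u, v.
rewrite negb_exists => /forallP no_uv.
have cl : closed (@sedge G) S.
  apply: (intro_closed (sym_connect_sym (@sedge_sym G))) => u v uv uS.
  apply: contraT => vS; have := no_uv u; rewrite negb_exists => /forallP/(_ v).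
  by rewrite uS vS uv.
by rewrite -(closed_connect cl xz) xS in zS.
Qed.

Section Order8.

Variables (G : sgraph) (mate : G -> G).
Hypotheses (G_conn : connected_graph G) (G8 : #|G| = 8).
Hypotheses (sum_degG : \sum_(v : G) deg v = 16) (mateP : perfect_mate mate).

Let mateK : involutive mate. Proof. by case: mateP. Qed.
Let mate_edge v : sedge v (mate v). Proof. by case: mateP. Qed.
Let mate_neq v : (mate v == v) = false.
Proof. by apply: contraTF (mate_edge v) => /eqP->; rewrite sedge_irrefl. Qed.

Let mate_closed (s : seq G) := forall v, v \in s -> mate v \in s.

(** Connectedness gives an edge leaving [s]; listing its outer end before the partner puts attached
    vertices at even positions. *)
Let extend (x : G) (s : seq G) : uniq s -> mate_closed s -> 0 < size s < 8 ->
  exists i y, [/\ i < size s, y \notin s, sedge (nth x s i) y,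
                  uniq (s ++ [:: y; mate y]) & mate_closed (s ++ [:: y; mate y])].
Proof.
move=> us cs /andP[s0 s8].
have [z zs] : exists z, z \notin s.
  apply/existsP; rewrite -negb_forall; apply/negP => /forallP s_all.
  have : #|G| <= size s.
    by rewrite -(card_uniqP us); apply/subset_leq_card/subsetP => v _; apply: s_all.
  by rewrite G8 leqNgt s8.
have [u [y [us' ys uy]]] := crossing_edge G_conn (mem_nth x s0) zs.
have mys : mate y \notin s by apply: contra ys => /cs; rewrite mateK.
exists (index u s), y; split=> //; first by rewrite index_mem.
- by rewrite nth_index.
- by rewrite cat_uniq us /= !inE (negbTE ys) (negbTE mys) eq_sym mate_neq.
move=> v; rewrite !mem_cat !inE => /or3P[/cs->//|/eqP->|/eqP->].
  by rewrite eqxx !orbT.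
by rewrite mateK eqxx !orbT.
Qed.

Let labelling : exists x (s : seq G) p q,
  [/\ uniq s, size s = 8, p < 4, q < 6 &
      {in matched_tree8 p q, forall e, sedge (nth x s e.1) (nth x s e.2)}].
Proof.
have [x _] : exists x : G, x \in G by apply/card_gt0P; rewrite G8.
have pair_uniq v : uniq [:: v; mate v] by rewrite /= inE eq_sym mate_neq.
have pair_closed v : mate_closed [:: v; mate v].
  by move=> w; rewrite !inE => /orP[]/eqP->; rewrite ?mateK eqxx ?orbT.
have [u [y [uy [us cs]]]] : exists u y, sedge u y /\
   (uniq [:: u; mate u; y; mate y] /\ mate_closed [:: u; mate u; y; mate y]).
  have [//|i [y [lt_i ys iy us cs]]] := extend x (pair_uniq x) (pair_closed x).
  case: i lt_i iy => [|[|]] //= _ iy; first by exists x, y.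
  (* The second pair is attached at label 1 here, so the first pair is swapped. *)
  have P : perm_eq [:: mate x; x; y; mate y] ([:: x; mate x] ++ [:: y; mate y]).
    by rewrite (perm_catCA [:: mate x] [:: x]).
  have U : uniq [:: mate x; x; y; mate y] by rewrite (perm_uniq P).
  exists (mate x), y; rewrite mateK; split=> //; split=> // v.
  by rewrite !(perm_mem P); apply: cs.
have [//|p [z [lt_p _ pz us2 cs2]]] := extend x us cs.
have [//|q [t [lt_q _ qt us3 _]]] := extend x us2 cs2.
exists x, (([:: u; mate u; y; mate y] ++ [:: z; mate z]) ++ [:: t; mate t]), p, q.
have pz' : sedge (nth x [:: u; mate u; y; mate y; z; mate z; t; mate t] p) z.
  by case: p lt_p pz => [|[|[|[|]]]].
have qt' : sedge (nth x [:: u; mate u; y; mate y; z; mate z; t; mate t] q) t.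
  by case: q lt_q qt => [|[|[|[|[|[|]]]]]].
split=> // e; rewrite !inE => /or4P[||| /or4P[]] /eqP-> //=.
Qed.

(** 377 is the value of the general formula at [m = 4]; the degree bound in the exceptional case is
    what the first induction step needs. *)
Lemma order8 : 377 <= ecc_dist_sum G \/
  [/\ ecc_dist_sum G = 373, giso G C5_111 & forall v : G, deg v <= 4].
Proof.
have [x [s [p [q [us ss lt_p lt_q tree]]]]] := labelling.
have sG : size s = #|G| by rewrite ss G8.
pose L := sym_arcs (matched_tree8 p q).
pose all64 := [seq (i, j) | i <- iota 0 8, j <- iota 0 8].
pose adj (e : nat * nat) := sedge (nth x s e.1) (nth x s e.2).
pose P := [seq e <- all64 | adj e].
have all64P i j : ((i, j) \in all64) = (i < 8) && (j < 8).
  apply/allpairsP/andP => [[[a b] [la lb [-> ->]]]|[lt_i lt_j]].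
    by move: la lb; rewrite !mem_iota.
  by exists (i, j); rewrite !mem_iota.
have uP : uniq P by rewrite filter_uniq // allpairs_uniq ?iota_uniq // => -[? ?] [? ?].
have sizeP : size P = 16.
  rewrite -sum_degG (sum_labels x us sG) G8 size_filter /all64 count_flatten.
  rewrite sumnE -map_comp big_map; apply: eq_bigr => i _.
  rewrite -[LHS]/(count adj [seq (i, j) | j <- iota 0 8]) count_map.
  by rewrite /deg (card_labels x us sG) G8; apply: eq_count.
have pi : p \in iota 0 4 by rewrite mem_iota.
have qi : q \in iota 0 6 by rewrite mem_iota.
have uL : uniq L.
  have /allP/(_ p pi)/allP/(_ q qi) // :
    all (fun p => all (fun q => uniq (sym_arcs (matched_tree8 p q))) (iota 0 6)) (iota 0 4).
  by vm_compute.
have memL es i j : ((i, j) \in sym_arcs es) = ((i, j) \in es) || ((j, i) \in es).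
  rewrite mem_cat; apply: (congr1 (orb _)); apply/mapP/idP => [[[a b] ab [-> ->]] //|ji].
  by exists (j, i).
have memP i j : i < 8 -> j < 8 -> ((i, j) \in P) = sedge (nth x s i) (nth x s j).
  by move=> lt_i lt_j; rewrite mem_filter all64P lt_i lt_j !andbT.
have ltP i j : (i, j) \in P -> i < 8 /\ j < 8.
  by rewrite mem_filter all64P => /andP[_ /andP[]].
have symP i j : (i, j) \in P -> (j, i) \in P.
  by move=> ijP; have [lt_i lt_j] := ltP _ _ ijP; move: ijP; rewrite !memP // sedge_sym.
have subP es : {subset es <= P} -> {subset sym_arcs es <= P}.
  by move=> esP [i j]; rewrite memL => /orP[/esP//|/esP/symP].
have treeP : {subset matched_tree8 p q <= P}.
  move=> [i j] ij; have [lt_i lt_j] : i < 8 /\ j < 8.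
    by move: ij; rewrite !inE => /or4P[||| /or4P[]] /eqP[-> ->]; split=> //; lia.
  by rewrite memP //; apply: (tree (i, j)).
have LP : {subset L <= P} by apply: subP.
(* [P] has 16 arcs and the tree only 14; the missing edge completes the graph, as [M] then has 16
   distinct arcs inside [P]. *)
have [i [j [lt_ij ijP ijL]]] : exists i j, [/\ i < j, (i, j) \in P & (i, j) \notin L].
  have [[i j] ijP ijL] : exists2 e, e \in P & e \notin L.
    apply/hasP; rewrite has_predC; apply/negP => /allP PL.
    by have := uniq_leq_size uP PL; rewrite sizeP.
  case: (ltngtP i j) => [lt_ij|lt_ji|eq_ij]; first by exists i, j.
    by exists j, i; rewrite lt_ji symP //; move: ijL; rewrite !memL orbC.
  by have [? ?] := ltP _ _ ijP; move: ijP; rewrite memP // eq_ij sedge_irrefl.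
have [lt_i lt_j] := ltP _ _ ijP.
pose M := sym_arcs ((i, j) :: matched_tree8 p q).
have uM : uniq M.
  have PM : perm_eq M [:: (i, j), (j, i) & L].
    by rewrite perm_cons (perm_catCA (matched_tree8 p q) [:: (j, i)]).
  have jiL : (j, i) \notin L by move: ijL; rewrite !memL orbC.
  by rewrite (perm_uniq PM) 2!cons_uniq uL jiL in_cons xpair_eqE ltn_eqF // ijL.
have MP : M =i P.
  have MP : {subset M <= P} by apply: subP => e; rewrite inE => /orP[/eqP->|/treeP].
  by have [|_] := uniq_min_size uM MP; rewrite ?sizeP.
have arcsM a b : a < #|G| -> b < #|G| ->
    sedge (nth x s a) (nth x s b) = ((a, b) \in M).
  by rewrite G8 => lt_a lt_b; rewrite MP memP.
have xiE := ecc_dist_sum_labelled G_conn us sG arcsM.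
have degE := deg_labelled us sG arcsM.
have : order8_check M.
  have ij_edge : (i, j) \in order8_edges.
    by apply/allpairsPdep; exists i, j; rewrite !mem_iota; split=> //; lia.
  have /allP/(_ p pi)/allP/(_ q qi)/allP/(_ _ ij_edge) := order8_checked.
  by case: ifP => // ij_tree; rewrite memL ij_tree in ijL.
rewrite G8 in xiE degE.
rewrite /order8_check -xiE; case: ifP => [|_]; first by left.
case: eqP => // xi373 /andP[/allP deg_le4 /hasP[t _ /and4P[/eqP st ut /allP t8 /allP tM]]].
right; split=> // [|v].
  have nth_t8 a : a < 8 -> nth 0 t a < 8 by move=> lt_a; apply: t8; rewrite mem_nth ?st.
  apply: (@giso_of_inj G C5_111 (fun z => nth x s (nth 0 t (C5_111_code z)))).
  - move=> y z /eqP; have ly := C5_111_code_lt y; have lz := C5_111_code_lt z.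
    rewrite nth_uniq ?ss ?nth_t8 // nth_uniq ?st // => /eqP.
    exact: (can_inj C5_111_codeK).
  - by rewrite G8 card_sum !card_ord.
  - move=> y z; have ly := C5_111_code_lt y; have lz := C5_111_code_lt z.
    rewrite arcsM ?G8 ?nth_t8 // C5_111_edge; apply/eqP.
    have in_iota a : a < 8 -> a \in iota 0 8 by rewrite mem_iota.
    by have /allP/(_ _ (in_iota _ lz)) := tM _ (in_iota _ ly).
have vs := mem_labels us sG v; rewrite -(nth_index x vs).
have lt_v : index v s < 8 by rewrite -ss index_mem.
by rewrite degE //; apply: deg_le4; rewrite mem_nth // size_mkseq.
Qed.

End Order8.

(** * Lower bound *)

Lemma matched_unicyclicW m G :
  unicyclic_class (2 * m) m G -> matched_unicyclic m G.
Proof.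
case=> /andP[G_conn /eqP E] cardG mG; split=> //.
  by rewrite handshake -E cardG; lia.
by apply: perfect_mate_exists; rewrite mG.
Qed.

Lemma pendant_path_dichotomy m G : 5 <= m -> matched_unicyclic m G ->
  43 * m ^ 2 - 92 * m + 57 < ecc_dist_sum G \/
  exists H : sgraph, exists c : G, exists c' : H,
    [/\ matched_unicyclic m.-1 H, deg c = (deg c').+1, deg c <= m.+1 &
        ecc_dist_sum H + (86 * m - 135) + 20 * (m.+1 - deg c) <= ecc_dist_sum G].
Proof.
move=> m5 GP; have [G_conn cardG sum_degG [mate mateP]] := GP.
have [mateK mate_edge] := mateP.
case: (boolP [exists l, (deg l == 1) && (deg (mate l) == 2)]) => [|no_path]; last first.
  left; apply: (@ecc_dist_sum_no_pendant_path G m mate) => // l l1.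
  by move: no_path; rewrite negb_exists => /forallP/(_ l); rewrite l1 eqxx.
case/existsP=> b /andP[/eqP b1 /eqP a2]; set a := mate b in a2.
have ba : sedge b a by apply: mate_edge.
have [c /andP[ac cb]] : exists c, sedge a c && (c != b).
  have := a2; rewrite /deg (cardsD1 b) inE sedge_sym ba add1n => -[card1].
  have /card_gt0P[c] : 0 < #|[set u | sedge a u] :\ b| by rewrite card1.
  by rewrite !inE => /andP[cb ac]; exists c; rewrite ac cb.
right; exists (induced (~: [set a; b])), c.
have cS : c \in ~: [set a; b].
  by rewrite !inE negb_or cb andbT; apply: contraTneq ac => ->; rewrite sedge_irrefl.
exists (Sub c cS); split.
- exact: (matched_unicyclic_del (c := c)).
- by rewrite (deg_del ba b1 a2 ac cb); congr (deg _).+1; apply: val_inj.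
- exact: (deg_le G_conn cardG sum_degG mateP).
- exact: (ecc_dist_sum_del m5).
Qed.

Lemma ecc_dist_sum_lower_bound m G : 5 <= m -> matched_unicyclic m G ->
  43 * m ^ 2 - 92 * m + 57 <= ecc_dist_sum G /\
  (ecc_dist_sum G = 43 * m ^ 2 - 92 * m + 57 -> exists c : G, deg c = m.+1).
Proof.
elim: m G => // m IHm G; rewrite ltnS leq_eqVlt => m4 GP.
have m5 : 5 <= m.+1 by lia.
have [lt|[H [c [c' [HP Ec le_c step]]]]] := pendant_path_dichotomy m5 GP.
  by split; lia.
(* In the first alternative equality forces the slack [20 * (m.+2 - deg c)] to vanish, so [c] is the
   required vertex; in the second equality is impossible. *)
suff [le_xi|lt_xi] : 43 * m.+1 ^ 2 - 92 * m.+1 + 57 <= ecc_dist_sum H + (86 * m.+1 - 135)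
    \/ 43 * m.+1 ^ 2 - 92 * m.+1 + 57 < ecc_dist_sum G.
- split=> [|E]; first by lia.
  by exists c; lia.
- by split; lia.
case/predU1P: m4 => [E4|m5']; last first.
  by left; have [+ _] := IHm H m5' HP; move: m5'; clear; nia.
subst m; have [H_conn H8 sum_degH [mate mateP]] := HP.
have [le377|[E373 _ deg4]] := order8 H_conn H8 sum_degH mateP; [left | right]; first by lia.
(* The deficit 4 of the exceptional graph is covered by a slack of at least 20, because
   [deg c <= 5]. *)
by have := deg4 c'; lia.
Qed.

Lemma giso_deg (G H : sgraph) (f : G -> H) (x : G) : bijective f ->
  (forall x y, sedge (f x) (f y) = sedge x y) -> deg (f x) = deg x.
Proof.
move=> f_bij fE; have f_inj := bij_inj f_bij.
rewrite /deg -(card_imset _ f_inj); apply: eq_card => z.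
have [g _ gK] := f_bij; rewrite -(gK z) inE fE.
apply/idP/imsetP => [xz|[y]]; first by exists (g z); rewrite ?inE.
by rewrite inE => ? /f_inj->.
Qed.

(** The hub misses only itself and the [m - 2] free ends among [2m] vertices. *)
Lemma giso_U_max_deg m (G : sgraph) : 2 <= m ->
  giso G (U_graph (2 * m) m) -> exists c : G, deg c = m.+1.
Proof.
move=> m2 [f f_bij fE]; have [g _ gK] := f_bij.
pose u : U_graph (2 * m) m := inl (inl ord0).
pose far_end (k : 'I_(m - 2)) : U_graph (2 * m) m := inr (k, true).
exists (g u); rewrite -(giso_deg _ f_bij fE) gK /deg.
have -> : [set w | sedge u w] = ~: (u |: far_end @: setT).
  apply/setP => w; rewrite !inE negb_or; case: (eqVneq w u) => [->|wu].
    by rewrite sedge_irrefl.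
  rewrite -[LHS]/((u != w) && _) eq_sym wu /=.
  have -> : (w \in far_end @: setT) = if w is inr (_, true) then true else false.
    apply/imsetP/idP => [[k _ ->] //|]; case: w {wu} => [//|[k []]] // _.
    by exists k.
  case: w wu => [[[[|i] lt_i]|i]|[k []]] //= /eqP[]; congr (inl (inl _)); exact: val_inj.
rewrite cardsCs setCK cardsU1 card_imset => [|k l [] //]; rewrite cardsT card_ord.
rewrite !card_sum card_prod card_bool !card_ord.
have -> : u \notin far_end @: setT by apply/imsetP => -[].
by move: m2; lia.
Qed.

Theorem theorem3p1 (m : nat) (G : sgraph) :
  4 <= m ->
  unicyclic_class (2 * m) m G ->
  (m = 4 ->
     373 <= ecc_dist_sum G /\
     (ecc_dist_sum G = 373 <-> giso G C5_111)) /\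
  (5 <= m ->
     43 * m ^ 2 - 92 * m + 57 <= ecc_dist_sum G /\
     (ecc_dist_sum G = 43 * m ^ 2 - 92 * m + 57 <->
      giso G (U_graph (2 * m) m))).
Proof.
move=> _ /matched_unicyclicW GP; have [G_conn cardG sum_degG [mate mateP]] := GP.
split=> [m4|m5].
  subst m; have [le377|[E373 isoG _]] := order8 G_conn cardG sum_degG mateP; last first.
    by rewrite E373; split.
  split; first exact: leq_trans le377.
  split=> [E|/(ecc_dist_sum_giso_C5_111 G_conn)//].
  by move: le377; rewrite E.
have [lb eq_max] := ecc_dist_sum_lower_bound m5 GP.
split=> //; split=> [/eq_max[c deg_c]|isoU].
  exact: (max_deg_giso G_conn cardG sum_degG mateP deg_c).
have [c deg_c] := giso_U_max_deg (leq_trans (isT : 2 <= 5) m5) isoU.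
(* The hub's degree alone gives the upper bound; the value follows by antisymmetry. *)
apply/eqP; rewrite eqn_leq lb andbT; exact: (ecc_dist_sum_max_deg G_conn cardG sum_degG mateP deg_c).
Qed.
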